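(* For a convex domain $\Omega$ and all $w\in\Omega$ we have $$\Omega\cap\mathcal{L}_w=\emptyset .$$ In particular, $\mathcal{P}_w\notin\Omega$.
   Context: $\mathbb{D}$ is the open unit disk and $\hat{\mathbb{C}}=\mathbb{C}\cup\{\infty\}$. The convex domain is $\Omega=f(\mathbb{D})$ for a conformal map $f$ of $\mathbb{D}$. The Ahlfors-Weill reflection $\mathcal{R}:\Omega\to\hat{\mathbb{C}}$, $w\mapsto\mathcal{R}_w$, is given by $$\mathcal{R}_{f(z)}=f(z)+\frac{(1-|z|^2)f'(z)}{\bar z-(1-|z|^2)\dfrac{f''(z)}{2f'(z)}},\qquad z\in\mathbb{D}.$$ For $w\in\Omega$, $\mathcal{L}_w$ denotes the mediatrix (perpendicular bisector) of the line segment $[w,\mathcal{R}_w]$, and $\mathcal{P}_w$ denotes the midpoint of this segment. *)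

(* Defs.v *)
From Stdlib Require Import Reals.
From Coquelicot Require Import Coquelicot.
Open Scope C_scope.

Inductive Chat : Set :=
  | Fin : C -> Chat
  | Infty : Chat.

Definition in_plane_set (A : C -> Prop) (p : Chat) : Prop :=
  match p with Fin q => A q | Infty => False end.

Definition unit_disk (z : C) : Prop := (Cmod z < 1)%R.

Definition image (f : C -> C) (A : C -> Prop) (w : C) : Prop :=
  exists z, A z /\ f z = w.

Definition convex (A : C -> Prop) : Prop :=
  forall (a b : C) (t : R), A a -> A b -> (0 <= t <= 1)%R ->
    A (RtoC (1 - t) * a + RtoC t * b).

Definition convex_domain (Omega : C -> Prop) : Prop :=
  open (T := C_UniformSpace) Omega /\ (exists w, Omega w) /\ convex Omega.

Definition holomorphic_on (A : C -> Prop) (f : C -> C) : Prop :=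
  forall z, A z -> ex_derive (K := C_AbsRing) (V := C_NormedModule) f z.

Definition injective_on (A : C -> Prop) (f : C -> C) : Prop :=
  forall z1 z2, A z1 -> A z2 -> f z1 = f z2 -> z1 = z2.

Definition conformal_on (A : C -> Prop) (f : C -> C) : Prop :=
  holomorphic_on A f /\ injective_on A f.

Definition AW_numerator (f : C -> C) (z : C) : C :=
  RtoC (1 - Cmod z ^ 2) * C_derive f z.

Definition AW_denominator (f : C -> C) (z : C) : C :=
  Cconj z
  - RtoC (1 - Cmod z ^ 2) * (C_derive (C_derive f) z / (2 * C_derive f z)).

(* The quotient is taken in the Riemann sphere.  For f conformal on the unit
   disk, f' has no zero there, so the numerator is nonzero and a vanishing
   denominator gives the value infinity. *)
Definition AW_value (f : C -> C) (z : C) : Chat :=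
  if Ceq_dec (AW_denominator f z) 0 then Infty
  else Fin (f z + AW_numerator f z / AW_denominator f z).

(* Only the values of [refl] on f(unit disk) are constrained; there [refl] is
   uniquely determined, and it exists because f is injective. *)
Definition is_AW_reflection (f : C -> C) (refl : C -> Chat) : Prop :=
  forall z, unit_disk z -> refl (f z) = AW_value f z.

Definition midpoint (w : C) (r : Chat) : Chat :=
  match r with
  | Fin v => Fin ((w + v) / 2)
  | Infty => Infty
  end.

(* The Euclidean line through the midpoint (w + v) / 2 orthogonal to v - w:
   Re (a * conj b) is the real inner product of a and b.  When the second
   endpoint is infinity, the line degenerates to the single point infinity. *)
Definition mediatrix (w : C) (r : Chat) (p : Chat) : Prop :=
  match r, p with
  | Fin v, Fin q => Re ((q - (w + v) / 2) * Cconj (v - w)) = 0%R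
  | Fin _, Infty => False
  | Infty, Fin _ => False
  | Infty, Infty => True
  end.

(* Main.v *)
(** Let [w = f z0].  For [q] in the convex domain and [0 <= t < 1] the map
    [g_t = f^-1 o ((1 - t) f + t q)] sends the disk into itself.  Schwarz-Pick at [z0] bounds
    [(1 - t) P(z0)] by [P(z_t)], where [P z = |f' z| (1 - |z|^2)] and [z_t = f^-1 (w + t (q - w))],
    with equality at [t = 0].  The derivative at [t = 0] is the inequality
    [Re ((q - w) / (R_w - w)) <= 1/2], which is strict because the domain is open; the mediatrix is
    the line of equality.

    The complex analysis needed rests on the mean value property of holomorphic functions, obtained
    from Goursat's theorem on rectangles through [z = c + e^w].  It yields Cauchy's estimate, the
    holomorphy of [f'], openness of injective maps (via [1 / (f - w)]) and [f' <> 0] (via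
    [(z - a) / (f z - f a)]). *)

Require Import Defs.
From Stdlib Require Import Reals Lra Psatz Classical IndefiniteDescription.
From Coquelicot Require Import Coquelicot.

(** * Complex derivatives *)

(** The Schwarz-Pick inequality meets the reflection because 1 / (R_w - w) comes from a logarithmic
    derivative. The curve z_t starts at z0 with velocity z' = (q - w) / f' z0, so log P changes at
    the rate Re (f'' z' / f') - 2 Re (conj z0 z') / (1 - |z0|^2), which is exactly -2 Re ((q - w) /
    (R_w - w)). The factor 1 - t contributes the rate -1, and comparing the two rates gives the
    constant 1/2. The half-plane inequality uses [AW_denominator f z0 / AW_numerator f z0] for 1 /
    (R_w - w), since this quotient also makes sense for an infinite reflection, where it is 0.

    Conformality means only injectivity and complex differentiability at each point. The reflection,
    however, contains f'' and divides by f', so the existence of the second derivative and the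
    absence of zeros of f' must be proved; this is what forces a piece of Cauchy's theory, starting
    from Goursat's theorem. *)

Section ComplexCalculus.
Local Open Scope R_scope.

(** The remainder bound is written as a product, with x = z allowed, so that the calculus rules
    reduce to triangle inequalities without quotients or filters. *)
Definition cderiv (f : C -> C) (z l : C) : Prop :=
  forall eps : R, 0 < eps -> exists d : R, 0 < d /\
    forall x : C, Cmod (x - z) < d ->
      Cmod (f x - f z - l * (x - z)) <= eps * Cmod (x - z).

Definition ccont (f : C -> C) (z : C) : Prop :=
  forall eps : R, 0 < eps -> exists d : R, 0 < d /\
    forall x : C, Cmod (x - z) < d -> Cmod (f x - f z) < eps.

Lemma Cmod_minus_sym (x y : C) : Cmod (x - y) = Cmod (y - x).
Proof. rewrite <- Cmod_opp; f_equal; ring. Qed.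

Lemma Cmod_minus_triangle (x y z : C) : Cmod (x - z) <= Cmod (x - y) + Cmod (y - z).
Proof. replace (x - z)%C with ((x - y) + (y - z))%C by ring; apply Cmod_triangle. Qed.

Lemma Cmod_triangle_rev (x y : C) : Cmod x - Cmod y <= Cmod (x - y).
Proof.
pose proof (Cmod_triangle (x - y) y) as H.
replace (x - y + y)%C with x in H by ring; lra.
Qed.

Lemma Cmod_self_minus (z : C) : Cmod (z - z) = 0.
Proof. replace (z - z)%C with (RtoC 0) by ring; apply Cmod_0. Qed.

Lemma Re_le_Cmod (z : C) : Re z <= Cmod z.
Proof. pose proof (re_le_Cmod z); pose proof (Rle_abs (Re z)); lra. Qed.

Lemma cderiv_is_derive (f : C -> C) (z l : C) :
  cderiv f z l <-> is_derive (K := C_AbsRing) (V := C_NormedModule) f z l.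
Proof.
split.
- intros H; split.
  + apply is_linear_scal_l.
  + intros x Hx eps.
    (* The library's definition ranges over all limits x of the neighbourhood filter of z; the only
       such limit is z. *)
    apply (is_filter_lim_locally_unique (V := AbsRing_NormedModule C_AbsRing)) in Hx; subst x.
    destruct (H eps (cond_pos eps)) as [d [Hd HH]].
    exists (mkposreal d Hd); intros x Hx.
    specialize (HH x Hx).
    change (Cmod (f x - f z - (x - z) * l) <= eps * Cmod (x - z)).
    now rewrite (Cmult_comm (x - z)).
- intros [_ H] eps Heps.
  specialize (H z (fun P HP => HP) (mkposreal eps Heps)).
  destruct H as [d Hd].
  exists d; split; [apply cond_pos|]; intros x Hx.
  specialize (Hd x Hx).
  change (Cmod (f x - f z - (x - z) * l) <= eps * Cmod (x - z)) in Hd.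
  now rewrite (Cmult_comm l).
Qed.

Lemma cderiv_ccont (f : C -> C) (z l : C) : cderiv f z l -> ccont f z.
Proof.
intros H eps Heps.
destruct (H 1 Rlt_0_1) as [d [Hd HH]].
pose proof (Cmod_ge_0 l) as Hl.
assert (Hq : 0 < eps / (2 + Cmod l)) by (apply Rdiv_lt_0_compat; lra).
exists (Rmin d (eps / (2 + Cmod l))); split; [now apply Rmin_pos|].
intros x Hx.
pose proof (Rlt_le_trans _ _ _ Hx (Rmin_l _ _)) as H1.
pose proof (Rlt_le_trans _ _ _ Hx (Rmin_r _ _)) as H2.
specialize (HH x H1).
assert (H3 : Cmod (f x - f z) <= (1 + Cmod l) * Cmod (x - z)).
{ replace (f x - f z)%C with ((f x - f z - l * (x - z)) + l * (x - z))%C by ring.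
  eapply Rle_trans; [apply Cmod_triangle|]. rewrite Cmod_mult; lra. }
assert (H4 : (2 + Cmod l) * Cmod (x - z) < eps).
{ apply (Rmult_lt_compat_l (2 + Cmod l)) in H2; [|lra].
  replace ((2 + Cmod l) * (eps / (2 + Cmod l))) with eps in H2 by (field; lra); lra. }
pose proof (Cmod_ge_0 (x - z)); lra.
Qed.

Lemma cderiv_ext_loc (f g : C -> C) (z l : C) (d : R) :
  0 < d -> (forall x, Cmod (x - z) < d -> f x = g x) -> cderiv f z l -> cderiv g z l.
Proof.
intros Hd He H eps Heps.
destruct (H eps Heps) as [d' [Hd' HH]].
exists (Rmin d d'); split; [now apply Rmin_pos|].
intros x Hx.
rewrite <- (He x), <- (He z).
- apply HH. eapply Rlt_le_trans; [apply Hx|apply Rmin_r].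
- now rewrite Cmod_self_minus.
- eapply Rlt_le_trans; [apply Hx|apply Rmin_l].
Qed.

Lemma cderiv_eq (f : C -> C) (z l m : C) : cderiv f z l -> l = m -> cderiv f z m.
Proof. now intros H <-. Qed.

Lemma cderiv_const (a z : C) : cderiv (fun _ => a) z 0.
Proof.
intros eps Heps; exists 1; split; [lra|]; intros x _.
replace (a - a - 0 * (x - z))%C with (RtoC 0) by ring.
rewrite Cmod_0. apply Rmult_le_pos; [lra|apply Cmod_ge_0].
Qed.

Lemma cderiv_id (z : C) : cderiv (fun x => x) z 1.
Proof.
intros eps Heps; exists 1; split; [lra|]; intros x _.
replace (x - z - 1 * (x - z))%C with (RtoC 0) by ring.
rewrite Cmod_0. apply Rmult_le_pos; [lra|apply Cmod_ge_0].
Qed.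

Lemma cderiv_plus (f g : C -> C) (z l m : C) :
  cderiv f z l -> cderiv g z m -> cderiv (fun x => f x + g x)%C z (l + m).
Proof.
intros Hf Hg eps Heps.
destruct (Hf (eps / 2)) as [d1 [Hd1 H1]]; [lra|].
destruct (Hg (eps / 2)) as [d2 [Hd2 H2]]; [lra|].
exists (Rmin d1 d2); split; [now apply Rmin_pos|]; intros x Hx.
specialize (H1 x (Rlt_le_trans _ _ _ Hx (Rmin_l _ _))).
specialize (H2 x (Rlt_le_trans _ _ _ Hx (Rmin_r _ _))).
replace (f x + g x - (f z + g z) - (l + m) * (x - z))%C
  with ((f x - f z - l * (x - z)) + (g x - g z - m * (x - z)))%C by ring.
eapply Rle_trans; [apply Cmod_triangle|]; lra.
Qed.

Lemma cderiv_mult (f g : C -> C) (z l m : C) :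
  cderiv f z l -> cderiv g z m ->
  cderiv (fun x => f x * g x)%C z (l * g z + f z * m).
Proof.
intros Hf Hg eps Heps.
pose proof (Cmod_ge_0 l) as P1; pose proof (Cmod_ge_0 (f z)) as P2.
pose proof (Cmod_ge_0 (g z)) as P3.
(* The remainder of the product splits into three terms, bounded by e |x - z| times |g z| + 1, |f z|
   and |l|. K is the sum of these factors, and e <= 1 ensures |g x| <= |g z| + 1. *)
set (K := Cmod l + Cmod (f z) + Cmod (g z) + 1).
assert (HK : 0 < K) by (unfold K; lra).
assert (He : 0 < eps / K) by now apply Rdiv_lt_0_compat.
set (e := Rmin 1 (eps / K)).
assert (He0 : 0 < e) by (apply Rmin_pos; lra).
assert (He1 : e <= 1) by apply Rmin_l.
assert (HeK : e * K <= eps).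
{ apply Rle_trans with (eps / K * K); [|right; field; lra].
  apply Rmult_le_compat_r; [lra|apply Rmin_r]. }
destruct (Hf e He0) as [d1 [Hd1 H1]].
destruct (Hg e He0) as [d2 [Hd2 H2]].
destruct (cderiv_ccont _ _ _ Hg e He0) as [d3 [Hd3 H3]].
exists (Rmin d1 (Rmin d2 d3)); split; [repeat apply Rmin_pos; assumption|]; intros x Hx.
pose proof (Rlt_le_trans _ _ _ Hx (Rmin_r _ _)) as Hx'.
specialize (H1 x (Rlt_le_trans _ _ _ Hx (Rmin_l _ _))).
specialize (H2 x (Rlt_le_trans _ _ _ Hx' (Rmin_l _ _))).
specialize (H3 x (Rlt_le_trans _ _ _ Hx' (Rmin_r _ _))).
replace (f x * g x - f z * g z - (l * g z + f z * m) * (x - z))%C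
  with ((f x - f z - l * (x - z)) * g x + f z * (g x - g z - m * (x - z))
        + l * (x - z) * (g x - g z))%C by ring.
eapply Rle_trans; [apply Cmod_triangle|].
eapply Rle_trans; [apply Rplus_le_compat_r, Cmod_triangle|].
rewrite !Cmod_mult.
assert (Hgx : Cmod (g x) <= Cmod (g z) + 1).
{ pose proof (Cmod_triangle_rev (g x) (g z)); lra. }
pose proof (Cmod_ge_0 (x - z)) as P4; pose proof (Cmod_ge_0 (g x)) as P5.
assert (A1 : Cmod (f x - f z - l * (x - z)) * Cmod (g x)
             <= e * Cmod (x - z) * (Cmod (g z) + 1)).
{ apply Rmult_le_compat; auto. apply Cmod_ge_0. }
assert (A2 : Cmod (f z) * Cmod (g x - g z - m * (x - z))
             <= Cmod (f z) * (e * Cmod (x - z))).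
{ now apply Rmult_le_compat_l. }
assert (A3 : Cmod l * Cmod (x - z) * Cmod (g x - g z) <= Cmod l * Cmod (x - z) * e).
{ apply Rmult_le_compat_l; [|lra]. now apply Rmult_le_pos. }
assert (A4 : e * K * Cmod (x - z) <= eps * Cmod (x - z)) by now apply Rmult_le_compat_r.
unfold K in A4; lra.
Qed.

Lemma cderiv_opp (f : C -> C) (z l : C) : cderiv f z l -> cderiv (fun x => - f x)%C z (- l).
Proof.
intros H eps Heps; destruct (H eps Heps) as [d [Hd HH]].
exists d; split; [easy|]; intros x Hx.
replace (- f x - - f z - - l * (x - z))%C with (- (f x - f z - l * (x - z)))%C by ring.
rewrite Cmod_opp; auto.
Qed.

Lemma cderiv_minus (f g : C -> C) (z l m : C) :
  cderiv f z l -> cderiv g z m -> cderiv (fun x => f x - g x)%C z (l - m).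
Proof. intros Hf Hg; exact (cderiv_plus _ _ _ _ _ Hf (cderiv_opp _ _ _ Hg)). Qed.

Lemma cderiv_comp (f g : C -> C) (z l m : C) :
  cderiv f (g z) l -> cderiv g z m -> cderiv (fun x => f (g x)) z (l * m).
Proof.
intros Hf Hg eps Heps.
pose proof (Cmod_ge_0 l) as P1; pose proof (Cmod_ge_0 m) as P2.
set (K := Cmod l + Cmod m + 1).
assert (HK : 0 < K) by (unfold K; lra).
assert (He : 0 < eps / K) by now apply Rdiv_lt_0_compat.
set (e := Rmin 1 (eps / K)).
assert (He0 : 0 < e) by (apply Rmin_pos; lra).
assert (He1 : e <= 1) by apply Rmin_l.
assert (HeK : e * K <= eps).
{ apply Rle_trans with (eps / K * K); [|right; field; lra].
  apply Rmult_le_compat_r; [lra|apply Rmin_r]. }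
destruct (Hf e He0) as [d1 [Hd1 H1]].
destruct (Hg e He0) as [d2 [Hd2 H2]].
destruct (cderiv_ccont _ _ _ Hg d1 Hd1) as [d3 [Hd3 H3]].
exists (Rmin d2 d3); split; [now apply Rmin_pos|]; intros x Hx.
specialize (H2 x (Rlt_le_trans _ _ _ Hx (Rmin_l _ _))).
specialize (H3 x (Rlt_le_trans _ _ _ Hx (Rmin_r _ _))).
specialize (H1 (g x) H3).
pose proof (Cmod_ge_0 (x - z)) as P4.
assert (Hgx : Cmod (g x - g z) <= (Cmod m + 1) * Cmod (x - z)).
{ replace (g x - g z)%C with ((g x - g z - m * (x - z)) + m * (x - z))%C by ring.
  eapply Rle_trans; [apply Cmod_triangle|]. rewrite Cmod_mult.
  assert (e * Cmod (x - z) <= 1 * Cmod (x - z)) by now apply Rmult_le_compat_r. lra. }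
replace (f (g x) - f (g z) - l * m * (x - z))%C
  with ((f (g x) - f (g z) - l * (g x - g z)) + l * (g x - g z - m * (x - z)))%C by ring.
eapply Rle_trans; [apply Cmod_triangle|]. rewrite Cmod_mult.
assert (A1 : e * Cmod (g x - g z) <= e * ((Cmod m + 1) * Cmod (x - z)))
  by (apply Rmult_le_compat_l; lra).
assert (A2 : Cmod l * Cmod (g x - g z - m * (x - z)) <= Cmod l * (e * Cmod (x - z)))
  by now apply Rmult_le_compat_l.
assert (A4 : e * K * Cmod (x - z) <= eps * Cmod (x - z)) by now apply Rmult_le_compat_r.
unfold K in A4; lra.
Qed.

Lemma cderiv_Cinv (z : C) : z <> 0 -> cderiv Cinv z (- / (z * z)).
Proof.
intros Hz eps Heps.
pose proof (proj1 (Cmod_gt_0 z) Hz) as Pz.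
(* The remainder is (x - z)^2 / (x z^2), and |x| >= |z| / 2 makes it at most 2 |x - z|^2 / |z|^3. *)
assert (Hq : 0 < eps * Cmod z ^ 3 / 2).
{ apply Rdiv_lt_0_compat; [|lra]. apply Rmult_lt_0_compat; [lra|now apply pow_lt]. }
exists (Rmin (Cmod z / 2) (eps * Cmod z ^ 3 / 2)); split; [apply Rmin_pos; lra|].
intros x Hx.
pose proof (Rlt_le_trans _ _ _ Hx (Rmin_l _ _)) as H1.
pose proof (Rlt_le_trans _ _ _ Hx (Rmin_r _ _)) as H2.
assert (Hx2 : Cmod z / 2 <= Cmod x).
{ pose proof (Cmod_triangle_rev z x) as H; rewrite Cmod_minus_sym in H; lra. }
assert (Hx0 : x <> 0) by (apply Cmod_gt_0; lra).
replace (/ x - / z - - / (z * z) * (x - z))%C with ((x - z) * (x - z) / (x * (z * z)))%C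
  by (field; auto).
rewrite Cmod_div, !Cmod_mult by (repeat apply Cmult_neq_0; auto).
apply Rle_div_l; [repeat apply Rmult_lt_0_compat; lra|].
rewrite (Rmult_assoc eps), (Rmult_comm (Cmod (x - z)) (Cmod x * _)), <- Rmult_assoc.
apply Rmult_le_compat_r; [apply Cmod_ge_0|].
apply Rle_trans with (eps * (Cmod z / 2 * (Cmod z * Cmod z))); [lra|].
apply Rmult_le_compat_l; [lra|]. apply Rmult_le_compat_r; [nra|lra].
Qed.

Lemma cderiv_inv (f : C -> C) (z l : C) :
  cderiv f z l -> f z <> 0 -> cderiv (fun x => / f x)%C z (- / (f z * f z) * l).
Proof. intros Hf Hz; exact (cderiv_comp _ _ _ _ _ (cderiv_Cinv _ Hz) Hf). Qed.

Lemma cderiv_div (f g : C -> C) (z l m : C) :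
  cderiv f z l -> cderiv g z m -> g z <> 0 ->
  cderiv (fun x => f x / g x)%C z ((l * g z - f z * m) / (g z * g z)).
Proof.
intros Hf Hg Hz; eapply cderiv_eq.
- exact (cderiv_mult _ _ _ _ _ Hf (cderiv_inv _ _ _ Hg Hz)).
- cbv beta; now field.
Qed.

Lemma cderiv_affine (a b z : C) : cderiv (fun x => a + x * b)%C z b.
Proof.
eapply cderiv_eq.
- apply cderiv_plus; [apply cderiv_const|].
  apply cderiv_mult; [apply cderiv_id|apply cderiv_const].
- cbv beta; ring.
Qed.

(** Gives access to the real mean value theorem and to the differentiation of real expressions along
    a complex curve. *)
Lemma is_derive_restrict_real (f : C -> C) (t : R) (l : C) :
  cderiv f t l ->
  is_derive (fun s : R => fst (f s)) t (fst l) /\ is_derive (fun s : R => snd (f s)) t (snd l).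
Proof.
intros H.
assert (HH : forall eps : R, 0 < eps -> exists d : R, 0 < d /\ forall s : R, Rabs (s - t) < d ->
  Rabs (fst (f s) - fst (f t) - (s - t) * fst l) <= eps * Rabs (s - t) /\
  Rabs (snd (f s) - snd (f t) - (s - t) * snd l) <= eps * Rabs (s - t)).
{ intros eps Heps; destruct (H eps Heps) as [d [Hd HH]].
  exists d; split; [easy|]; intros s Hs.
  specialize (HH s); rewrite <- RtoC_minus, Cmod_R in HH; specialize (HH Hs).
  pose proof (Rmax_Cmod (f s - f t - l * RtoC (s - t))%C) as HM.
  assert (E1 : fst (f s - f t - l * RtoC (s - t))%C = fst (f s) - fst (f t) - (s - t) * fst l)
    by (simpl; ring).
  assert (E2 : snd (f s - f t - l * RtoC (s - t))%C = snd (f s) - snd (f t) - (s - t) * snd l)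
    by (simpl; ring).
  rewrite E1, E2 in HM.
  split; (eapply Rle_trans; [|apply HH]); (eapply Rle_trans; [|apply HM]);
    [apply Rmax_l|apply Rmax_r]. }
split; (split; [apply is_linear_scal_l|]); intros x Hx eps;
  apply (is_filter_lim_locally_unique (V := R_NormedModule)) in Hx; subst x;
  destruct (HH eps (cond_pos eps)) as [d [Hd HHd]];
  exists (mkposreal d Hd); intros s Hs; apply HHd, Hs.
Qed.

(* Projecting [f y - f x] on its own direction reduces to the real mean value theorem. *)
Lemma cderiv_mean_value_le (f f' : C -> C) (x y : C) (K : R) :
  (forall t : R, 0 <= t <= 1 -> cderiv f (x + t * (y - x))%C (f' (x + t * (y - x))%C)) ->
  (forall t : R, 0 <= t <= 1 -> Cmod (f' (x + t * (y - x))%C) <= K) ->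
  Cmod (f y - f x) <= K * Cmod (y - x).
Proof.
intros Hd HK.
set (u := (f y - f x)%C).
set (F := fun s : C => (Cconj u * f (x + s * (y - x)))%C).
assert (HF : forall t : R, 0 <= t <= 1 ->
  cderiv F t (Cconj u * (f' (x + t * (y - x)) * (y - x)))%C).
{ intros t Ht; unfold F; eapply cderiv_eq.
  - apply cderiv_mult; [apply cderiv_const|].
    apply (cderiv_comp f (fun s => x + s * (y - x))%C); [now apply Hd|apply cderiv_affine].
  - cbv beta; ring. }
destruct (MVT_gen (fun s : R => fst (F s)) 0 1
  (fun s : R => fst (Cconj u * (f' (x + s * (y - x)) * (y - x)))%C)) as [c [Hc Hmv]].
- intros t Ht; rewrite Rmin_left, Rmax_right in Ht by lra.
  apply is_derive_restrict_real, HF; lra.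
- intros t Ht; rewrite Rmin_left, Rmax_right in Ht by lra.
  apply continuity_pt_filterlim, (ex_derive_continuous (fun s : R => fst (F s)) t).
  eexists; apply (proj1 (is_derive_restrict_real _ _ _ (HF t Ht))).
- rewrite Rmin_left, Rmax_right in Hc by lra.
  assert (E : fst (F 1) - fst (F 0) = Cmod u ^ 2).
  { assert (E1 : F 1 = (Cconj u * f y)%C) by (unfold F; f_equal; f_equal; ring).
    assert (E0 : F 0 = (Cconj u * f x)%C) by (unfold F; f_equal; f_equal; ring).
    rewrite E1, E0, Cmod2_alt. unfold u, Re, Im; simpl; ring. }
  rewrite E in Hmv.
  assert (B : fst (Cconj u * (f' (x + c * (y - x)) * (y - x)))%C
              <= Cmod u * (K * Cmod (y - x))).
  { eapply Rle_trans; [apply Re_le_Cmod|]. rewrite !Cmod_mult, Cmod_conj.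
    apply Rmult_le_compat_l; [apply Cmod_ge_0|].
    apply Rmult_le_compat_r; [apply Cmod_ge_0|]. now apply HK. }
  (* The mean value theorem yields |u|^2 <= |u| K |y - x|; cancelling |u| needs u nonzero, and for u
     = 0 it suffices that K dominates a modulus. *)
  destruct (Rle_lt_or_eq_dec 0 (Cmod u) (Cmod_ge_0 u)) as [Hu|Hu].
  + apply Rmult_le_reg_l with (Cmod u); [easy|]. simpl in Hmv; simpl in *; nra.
  + rewrite <- Hu. apply Rmult_le_pos; [|apply Cmod_ge_0].
    eapply Rle_trans; [apply Cmod_ge_0|apply (HK c Hc)].
Qed.

End ComplexCalculus.

(** * Goursat's theorem on rectangles *)

Section RectangleIntegrals.
Local Open Scope R_scope.

Definition path_cont (g : R -> C) (t : R) : Prop :=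
  forall eps : R, 0 < eps -> exists d : R, 0 < d /\
    forall s : R, Rabs (s - t) < d -> Cmod (g s - g t) < eps.

Lemma path_cont_continuous (g : R -> C) (t : R) :
  path_cont g t -> continuous (U := C_UniformSpace) g t.
Proof.
intros H; apply filterlim_locally; intros eps.
destruct (H eps (cond_pos eps)) as [d [Hd HH]].
exists (mkposreal d Hd); intros s Hs.
apply C_NormedModule_mixin_compat1, HH, Hs.
Qed.

Lemma path_cont_comp (F : C -> C) (g : R -> C) (t : R) :
  ccont F (g t) -> path_cont g t -> path_cont (fun s => F (g s)) t.
Proof.
intros HF Hg eps Heps.
destruct (HF eps Heps) as [d [Hd HH]].
destruct (Hg d Hd) as [d' [Hd' HH']].
exists d'; split; auto.
Qed.

Lemma Cmod_le_abs (x y : R) : Cmod (x, y) <= Rabs x + Rabs y.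
Proof.
replace (x, y) with (RtoC x + Ci * RtoC y)%C
  by (unfold RtoC, Ci, Cmult, Cplus; simpl; f_equal; ring).
eapply Rle_trans; [apply Cmod_triangle|].
rewrite Cmod_mult, Cmod_Ci, !Cmod_R; lra.
Qed.

Lemma path_cont_horizontal (v t : R) : path_cont (fun u => (u, v)) t.
Proof.
intros eps Heps; exists eps; split; [easy|]; intros s Hs.
eapply Rle_lt_trans; [apply Cmod_le_abs|]; simpl.
replace (v + - v) with 0 by ring. rewrite Rabs_R0. unfold Rminus in Hs; lra.
Qed.

Lemma path_cont_vertical (u t : R) : path_cont (fun v => (u, v)) t.
Proof.
intros eps Heps; exists eps; split; [easy|]; intros s Hs.
eapply Rle_lt_trans; [apply Cmod_le_abs|]; simpl.
replace (u + - u) with 0 by ring. rewrite Rabs_R0. unfold Rminus in Hs; lra.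
Qed.

Definition RIntC (g : R -> C) (a b : R) : C := RInt (V := C_R_CompleteNormedModule) g a b.

Definition ex_RIntC (g : R -> C) (a b : R) : Prop := ex_RInt (V := C_R_NormedModule) g a b.

Lemma ex_RIntC_path_cont (g : R -> C) (a b : R) :
  a <= b -> (forall t, a <= t <= b -> path_cont g t) -> ex_RIntC g a b.
Proof.
intros Hab H; apply (ex_RInt_continuous (V := C_R_CompleteNormedModule)).
intros t Ht; rewrite Rmin_left, Rmax_right in Ht by easy.
now apply path_cont_continuous, H.
Qed.

Lemma RIntC_Chasles (g : R -> C) (a b c : R) :
  ex_RIntC g a b -> ex_RIntC g b c -> (RIntC g a b + RIntC g b c)%C = RIntC g a c.
Proof. apply (RInt_Chasles (V := C_R_CompleteNormedModule)). Qed.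

Lemma RIntC_plus (g h : R -> C) (a b : R) :
  ex_RIntC g a b -> ex_RIntC h a b ->
  RIntC (fun t => g t + h t)%C a b = (RIntC g a b + RIntC h a b)%C.
Proof. apply (RInt_plus (V := C_R_CompleteNormedModule)). Qed.

Lemma RIntC_minus (g h : R -> C) (a b : R) :
  ex_RIntC g a b -> ex_RIntC h a b ->
  RIntC (fun t => g t - h t)%C a b = (RIntC g a b - RIntC h a b)%C.
Proof. apply (RInt_minus (V := C_R_CompleteNormedModule)). Qed.

Lemma RIntC_ext (g h : R -> C) (a b : R) :
  (forall t, g t = h t) -> RIntC g a b = RIntC h a b.
Proof. intros H; apply (RInt_ext (V := C_R_CompleteNormedModule)); auto. Qed.

Lemma RIntC_const (k : C) (a b : R) : RIntC (fun _ => k) a b = (RtoC (b - a) * k)%C.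
Proof.
unfold RIntC; rewrite (RInt_const (V := C_R_CompleteNormedModule)). apply scal_R_Cmult.
Qed.

Lemma ex_RIntC_const (k : C) (a b : R) : ex_RIntC (fun _ => k) a b.
Proof. apply (ex_RInt_const (V := C_R_NormedModule)). Qed.

Lemma ex_RIntC_minus (g h : R -> C) (a b : R) :
  ex_RIntC g a b -> ex_RIntC h a b -> ex_RIntC (fun t => g t - h t)%C a b.
Proof. apply (ex_RInt_minus (V := C_R_NormedModule)). Qed.

Lemma Cmod_RIntC_le (g : R -> C) (a b M : R) :
  a <= b -> ex_RIntC g a b -> (forall t, a <= t <= b -> Cmod (g t) <= M) ->
  Cmod (RIntC g a b) <= (b - a) * M.
Proof.
intros Hab Hex HM; rewrite Cmod_norm.
apply (norm_RInt_le_const (V := C_R_NormedModule) g a b _ M Hab).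
- intros t Ht; rewrite <- Cmod_norm; auto.
- now apply (RInt_correct (V := C_R_CompleteNormedModule)).
Qed.

Lemma RIntC_near_const (g : R -> C) (k : C) (a b M : R) :
  a <= b -> ex_RIntC g a b -> (forall t, a <= t <= b -> Cmod (g t - k) <= M) ->
  Cmod (RIntC g a b - RtoC (b - a) * k) <= (b - a) * M.
Proof.
intros Hab Hex HM.
rewrite <- RIntC_const, <- RIntC_minus; auto using ex_RIntC_const.
apply Cmod_RIntC_le; auto using ex_RIntC_minus, ex_RIntC_const.
Qed.

(** The integral sees C as a real vector space, so linearity for a complex factor is obtained from
    the real and imaginary parts. *)
Lemma RIntC_Cmult (k : C) (g : R -> C) (a b : R) :
  ex_RIntC g a b -> RIntC (fun t => k * g t)%C a b = (k * RIntC g a b)%C.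
Proof.
intros Hex.
apply (RInt_correct (V := C_R_CompleteNormedModule)) in Hex.
change (RInt (V := C_R_CompleteNormedModule) g a b) with (RIntC g a b) in Hex.
apply (is_RInt_unique (V := C_R_CompleteNormedModule)).
destruct (RIntC g a b) as [p q] eqn:E.
pose proof (is_RInt_fct_extend_fst (U := R_NormedModule) (V := R_NormedModule) _ _ _ _ Hex) as H1.
pose proof (is_RInt_fct_extend_snd (U := R_NormedModule) (V := R_NormedModule) _ _ _ _ Hex) as H2.
apply (is_RInt_fct_extend_pair (U := R_NormedModule) (V := R_NormedModule)); simpl.
- apply (is_RInt_minus (V := R_NormedModule)); now apply (is_RInt_scal (V := R_NormedModule)).
- apply (is_RInt_plus (V := R_NormedModule)); now apply (is_RInt_scal (V := R_NormedModule)).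
Qed.

(* This is [-i] times the contour integral of [G], so that no factor stands before the vertical sides. *)
Definition boundary_integral (G : C -> C) (a b c d : R) : C :=
  (RIntC (fun u => - Ci * (G (u, c) - G (u, d))) a b
   + RIntC (fun v => G (b, v) - G (a, v)) c d)%C.

Definition ccont_rect (G : C -> C) (a b c d : R) : Prop :=
  forall u v : R, a <= u <= b -> c <= v <= d -> ccont G (u, v).

Lemma ex_RIntC_horizontal (G : C -> C) (a b v : R) :
  a <= b -> (forall u, a <= u <= b -> ccont G (u, v)) -> ex_RIntC (fun u => G (u, v)) a b.
Proof.
intros Hab H; apply ex_RIntC_path_cont; [easy|]; intros t Ht.
apply path_cont_comp; [now apply H|apply path_cont_horizontal].
Qed.

Lemma ex_RIntC_vertical (G : C -> C) (c d u : R) :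
  c <= d -> (forall v, c <= v <= d -> ccont G (u, v)) -> ex_RIntC (fun v => G (u, v)) c d.
Proof.
intros Hcd H; apply ex_RIntC_path_cont; [easy|]; intros t Ht.
apply path_cont_comp; [now apply H|apply path_cont_vertical].
Qed.

Lemma ex_RIntC_Cmult (k : C) (g : R -> C) (a b : R) :
  ex_RIntC g a b -> ex_RIntC (fun t => k * g t)%C a b.
Proof.
intros [[p q] Hex].
pose proof (is_RInt_fct_extend_fst (U := R_NormedModule) (V := R_NormedModule) _ _ _ _ Hex) as H1.
pose proof (is_RInt_fct_extend_snd (U := R_NormedModule) (V := R_NormedModule) _ _ _ _ Hex) as H2.
eexists.
apply (is_RInt_fct_extend_pair (U := R_NormedModule) (V := R_NormedModule)); simpl.
- apply (is_RInt_minus (V := R_NormedModule)); apply (is_RInt_scal (V := R_NormedModule)); eassumption.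
- apply (is_RInt_plus (V := R_NormedModule)); apply (is_RInt_scal (V := R_NormedModule)); eassumption.
Qed.

Lemma boundary_integral_split_h (G : C -> C) (a m b c d : R) :
  a <= m <= b -> c <= d -> ccont_rect G a b c d ->
  boundary_integral G a b c d
  = (boundary_integral G a m c d + boundary_integral G m b c d)%C.
Proof.
intros Hm Hcd H; unfold boundary_integral.
rewrite <- (RIntC_Chasles _ a m b).
- rewrite (RIntC_ext (fun v => G (b, v) - G (a, v))%C
    (fun v => (G (m, v) - G (a, v)) + (G (b, v) - G (m, v)))%C) by (intros; ring).
  rewrite RIntC_plus; [ring| |];
    apply ex_RIntC_minus; apply ex_RIntC_vertical; auto; intros; apply H; lra.
- apply ex_RIntC_Cmult, ex_RIntC_minus; apply ex_RIntC_horizontal; try lra; intros; apply H; lra.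
- apply ex_RIntC_Cmult, ex_RIntC_minus; apply ex_RIntC_horizontal; try lra; intros; apply H; lra.
Qed.

Lemma boundary_integral_split_v (G : C -> C) (a b c m d : R) :
  a <= b -> c <= m <= d -> ccont_rect G a b c d ->
  boundary_integral G a b c d
  = (boundary_integral G a b c m + boundary_integral G a b m d)%C.
Proof.
intros Hab Hm H; unfold boundary_integral.
rewrite <- (RIntC_Chasles _ c m d).
- rewrite (RIntC_ext (fun u => - Ci * (G (u, c) - G (u, d)))%C
    (fun u => - Ci * (G (u, c) - G (u, m)) + - Ci * (G (u, m) - G (u, d)))%C) by (intros; ring).
  rewrite RIntC_plus; [ring| |];
    apply ex_RIntC_Cmult, ex_RIntC_minus; apply ex_RIntC_horizontal; auto; intros; apply H; lra.
- apply ex_RIntC_minus; apply ex_RIntC_vertical; try lra; intros; apply H; lra.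
- apply ex_RIntC_minus; apply ex_RIntC_vertical; try lra; intros; apply H; lra.
Qed.

(* Affine functions have zero boundary integral, so only the remainder contributes. *)
Lemma boundary_integral_near_affine (G : C -> C) (a b c d : R) (g l p : C) (M : R) :
  a <= b -> c <= d -> ccont_rect G a b c d ->
  (forall u v, a <= u <= b -> c <= v <= d -> Cmod (G (u, v) - g - l * ((u, v) - p)) <= M) ->
  Cmod (boundary_integral G a b c d) <= 2 * M * ((b - a) + (d - c)).
Proof.
intros Hab Hcd Hc HM; unfold boundary_integral.
assert (E : forall u v u' v' : R,
  ((G (u, v) - G (u', v')) - l * ((u - u')%R, (v - v')%R)
   = (G (u, v) - g - l * ((u, v) - p)) - (G (u', v') - g - l * ((u', v') - p)))%C).
{ intros u v u' v'.
  replace ((u - u')%R, (v - v')%R) with ((u, v) - (u', v'))%C by reflexivity. ring. }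
pose proof (RIntC_near_const (fun u => - Ci * (G (u, c) - G (u, d)))%C
  (- Ci * (l * (0%R, (c - d)%R))) a b (2 * M) Hab) as H1.
pose proof (RIntC_near_const (fun v => G (b, v) - G (a, v))%C
  (l * ((b - a)%R, 0%R)) c d (2 * M) Hcd) as H2.
assert (Hx1 : ex_RIntC (fun u => - Ci * (G (u, c) - G (u, d)))%C a b).
{ apply ex_RIntC_Cmult, ex_RIntC_minus; apply ex_RIntC_horizontal; try lra; intros; apply Hc; lra. }
assert (Hx2 : ex_RIntC (fun v => G (b, v) - G (a, v))%C c d).
{ apply ex_RIntC_minus; apply ex_RIntC_vertical; try lra; intros; apply Hc; lra. }
specialize (H1 Hx1); specialize (H2 Hx2).
assert (H1' : Cmod (RIntC (fun u => - Ci * (G (u, c) - G (u, d)))%C a b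
  - RtoC (b - a) * (- Ci * (l * (0%R, (c - d)%R)))) <= (b - a) * (2 * M)).
{ apply H1; intros t Ht.
  replace (- Ci * (G (t, c) - G (t, d)) - - Ci * (l * (0%R, (c - d)%R)))%C
    with (- Ci * ((G (t, c) - G (t, d)) - l * ((t - t)%R, (c - d)%R)))%C
    by (replace (t - t) with 0 by ring; ring).
  rewrite Cmod_mult, Cmod_opp, Cmod_Ci, E.
  unfold Cminus at 1; eapply Rle_trans; [apply Rmult_le_compat_l, Cmod_triangle; lra|].
  rewrite Cmod_opp.
  pose proof (HM t c Ht ltac:(lra)); pose proof (HM t d Ht ltac:(lra)); lra. }
assert (H2' : Cmod (RIntC (fun v => G (b, v) - G (a, v))%C c d
  - RtoC (d - c) * (l * ((b - a)%R, 0%R))) <= (d - c) * (2 * M)).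
{ apply H2; intros t Ht.
  replace ((b - a)%R, 0%R) with ((b - a)%R, (t - t)%R) by (f_equal; ring).
  rewrite E.
  unfold Cminus at 1; eapply Rle_trans; [apply Cmod_triangle|].
  rewrite Cmod_opp.
  pose proof (HM a t ltac:(lra) Ht); pose proof (HM b t ltac:(lra) Ht); lra. }
match goal with |- Cmod (?X + ?Y) <= _ =>
  replace (X + Y)%C with ((X - RtoC (b - a) * (- Ci * (l * (0%R, (c - d)%R))))
    + (Y - RtoC (d - c) * (l * ((b - a)%R, 0%R))))%C end.
- eapply Rle_trans; [apply Cmod_triangle|]; lra.
(* The affine part contributes (b - a)(c - d) l from the horizontal sides and (d - c)(b - a) l from
   the vertical ones. *)
- assert (Z : (RtoC (b - a) * (- Ci * (l * (0%R, (c - d)%R)))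
    + RtoC (d - c) * (l * ((b - a)%R, 0%R)) = 0)%C)
    by (destruct l; unfold Cmult, Cplus, Copp, Ci, RtoC; simpl; f_equal; ring).
  match goal with |- (?A - ?B + (?A' - ?B') = _)%C =>
    replace (A - B + (A' - B'))%C with (A + A' - (B + B'))%C by ring end.
  rewrite Z; ring.
Qed.

(** Left ends increase and right ends decrease, so every right end bounds all left ends; the
    supremum of the left ends lies in every interval. *)
Lemma nested_halves (x : nat -> R) (s : R) :
  0 <= s ->
  (forall n, x n <= x (S n) /\ x (S n) + s / 2 ^ (S n) <= x n + s / 2 ^ n) ->
  exists p, forall n, x n <= p <= x n + s / 2 ^ n.
Proof.
intros Hs H.
assert (Hpos : forall n, 0 <= s / 2 ^ n).
{ intros n; apply Rle_div_r; [apply pow_lt; lra|lra]. }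
assert (Hinc : forall n k, x n <= x (n + k)%nat).
{ intros n k; induction k as [|k IH]; [rewrite Nat.add_0_r; lra|].
  rewrite Nat.add_succ_r; pose proof (proj1 (H (n + k)%nat)); lra. }
assert (Hdec : forall n k, x (n + k)%nat + s / 2 ^ (n + k) <= x n + s / 2 ^ n).
{ intros n k; induction k as [|k IH]; [rewrite Nat.add_0_r; lra|].
  rewrite Nat.add_succ_r; pose proof (proj2 (H (n + k)%nat)); lra. }
assert (Hub : forall n m, x m <= x n + s / 2 ^ n).
{ intros n m. destruct (Nat.le_ge_cases n m) as [Hnm|Hnm].
  - replace m with (n + (m - n))%nat by lia.
    pose proof (Hdec n (m - n)%nat); pose proof (Hpos (n + (m - n))%nat); lra.
  - replace n with (m + (n - m))%nat by lia.
    pose proof (Hinc m (n - m)%nat); pose proof (Hpos (m + (n - m))%nat); lra. }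
destruct (completeness (fun y => exists n, y = x n)) as [p [Hp1 Hp2]].
- exists (x 0%nat + s / 2 ^ 0); intros y [n ->]; apply Hub.
- now exists (x 0%nat), 0%nat.
- exists p; intros n; split; [apply Hp1; now exists n|].
  apply Hp2; intros y [m ->]; apply Hub.
Qed.

(** Left end of a half carrying at least half of the modulus of the boundary integral. Deciding the
    comparison makes this a function, so the nested rectangles are defined by recursion instead of
    choice. *)
Definition left_half (G : C -> C) (a s c d : R) : R :=
  if Rle_dec (Cmod (boundary_integral G a (a + s) c d))
             (2 * Cmod (boundary_integral G a (a + s / 2) c d))
  then a else a + s / 2.

Definition lower_half (G : C -> C) (a b c t : R) : R :=
  if Rle_dec (Cmod (boundary_integral G a b c (c + t)))
             (2 * Cmod (boundary_integral G a b c (c + t / 2)))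
  then c else c + t / 2.

(** Only the lower left corner is recorded, since after n rounds the sides are s / 2^n and t / 2^n.
    A round halves the width and then the height, which replaces the choice among four quarters. *)
Fixpoint bisect (G : C -> C) (a c s t : R) (n : nat) : R * R :=
  match n with
  | O => (a, c)
  | S n =>
    let (a, c) := bisect G a c s t n in
    let a' := left_half G a (s / 2 ^ n) c (c + t / 2 ^ n) in
    (a', lower_half G a' (a' + s / 2 ^ n / 2) c (t / 2 ^ n))
  end.

Lemma left_half_spec (G : C -> C) (a s c d : R) :
  0 <= s -> c <= d -> ccont_rect G a (a + s) c d ->
  let a' := left_half G a s c d in
  a <= a' /\ a' + s / 2 <= a + s /\
  Cmod (boundary_integral G a (a + s) c d)
  <= 2 * Cmod (boundary_integral G a' (a' + s / 2) c d).
Proof.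
intros Hs Hcd H; unfold left_half.
destruct (Rle_dec _ _) as [HL|HL]; [repeat split; lra|].
split; [lra|]; split; [lra|].
rewrite (boundary_integral_split_h G a (a + s / 2) (a + s)) in HL |- * by (auto; lra).
replace (a + s / 2 + s / 2) with (a + s) by lra.
pose proof (Cmod_triangle (boundary_integral G a (a + s / 2) c d)
  (boundary_integral G (a + s / 2) (a + s) c d)); lra.
Qed.

Lemma lower_half_spec (G : C -> C) (a b c t : R) :
  a <= b -> 0 <= t -> ccont_rect G a b c (c + t) ->
  let c' := lower_half G a b c t in
  c <= c' /\ c' + t / 2 <= c + t /\
  Cmod (boundary_integral G a b c (c + t))
  <= 2 * Cmod (boundary_integral G a b c' (c' + t / 2)).
Proof.
intros Hab Ht H; unfold lower_half.
destruct (Rle_dec _ _) as [HL|HL]; [repeat split; lra|].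
split; [lra|]; split; [lra|].
rewrite (boundary_integral_split_v G a b c (c + t / 2) (c + t)) in HL |- * by (auto; lra).
replace (c + t / 2 + t / 2) with (c + t) by lra.
pose proof (Cmod_triangle (boundary_integral G a b c (c + t / 2))
  (boundary_integral G a b (c + t / 2) (c + t))); lra.
Qed.

(** Each of the two halvings in a round costs at most a factor 2, whence 4^n. *)
Lemma bisect_spec (G : C -> C) (a c s t : R) (n : nat) :
  0 <= s -> 0 <= t -> ccont_rect G a (a + s) c (c + t) ->
  let (an, cn) := bisect G a c s t n in
  a <= an /\ an + s / 2 ^ n <= a + s /\ c <= cn /\ cn + t / 2 ^ n <= c + t /\
  Cmod (boundary_integral G a (a + s) c (c + t))
  <= 4 ^ n * Cmod (boundary_integral G an (an + s / 2 ^ n) cn (cn + t / 2 ^ n)).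
Proof.
intros Hs Ht HG; induction n as [|n IH]; simpl bisect.
- simpl. unfold Rdiv; rewrite Rinv_1, !Rmult_1_r, Rmult_1_l; lra.
- destruct (bisect G a c s t n) as [an cn].
  destruct IH as [I1 [I2 [I3 [I4 I5]]]].
  assert (P : 0 < 2 ^ n) by (apply pow_lt; lra).
  assert (Hsn : 0 <= s / 2 ^ n) by (apply Rle_div_r; lra).
  assert (Htn : 0 <= t / 2 ^ n) by (apply Rle_div_r; lra).
  replace (s / 2 ^ S n) with (s / 2 ^ n / 2) by (simpl; field; lra).
  replace (t / 2 ^ S n) with (t / 2 ^ n / 2) by (simpl; field; lra).
  set (sn := s / 2 ^ n) in *; set (tn := t / 2 ^ n) in *.
  destruct (left_half_spec G an sn cn (cn + tn)) as [L1 [L2 L3]]; [lra|lra| |].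
  { intros u v Hu Hv; apply HG; lra. }
  set (a' := left_half G an sn cn (cn + tn)) in *.
  destruct (lower_half_spec G a' (a' + sn / 2) cn tn) as [M1 [M2 M3]]; [lra|lra| |].
  { intros u v Hu Hv; apply HG; lra. }
  set (c' := lower_half G a' (a' + sn / 2) cn tn) in *.
  repeat split; try lra.
  eapply Rle_trans; [apply I5|].
  replace (4 ^ S n) with (4 ^ n * 4) by (simpl; ring).
  rewrite Rmult_assoc; apply Rmult_le_compat_l; [apply pow_le; lra|lra].
Qed.

Lemma bisect_step (G : C -> C) (a c s t : R) (n : nat) :
  0 <= s -> 0 <= t -> ccont_rect G a (a + s) c (c + t) ->
  let (an, cn) := bisect G a c s t n in
  let (am, cm) := bisect G a c s t (S n) in
  (an <= am /\ am + s / 2 ^ S n <= an + s / 2 ^ n) /\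
  (cn <= cm /\ cm + t / 2 ^ S n <= cn + t / 2 ^ n).
Proof.
intros Hs Ht HG; pose proof (bisect_spec G a c s t n Hs Ht HG) as IH; simpl bisect.
destruct (bisect G a c s t n) as [an cn].
destruct IH as [I1 [I2 [I3 [I4 I5]]]].
assert (P : 0 < 2 ^ n) by (apply pow_lt; lra).
assert (Hsn : 0 <= s / 2 ^ n) by (apply Rle_div_r; lra).
assert (Htn : 0 <= t / 2 ^ n) by (apply Rle_div_r; lra).
replace (s / 2 ^ S n) with (s / 2 ^ n / 2) by (simpl; field; lra).
replace (t / 2 ^ S n) with (t / 2 ^ n / 2) by (simpl; field; lra).
set (sn := s / 2 ^ n) in *; set (tn := t / 2 ^ n) in *.
destruct (left_half_spec G an sn cn (cn + tn)) as [L1 [L2 L3]]; [lra|lra| |].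
{ intros u v Hu Hv; apply HG; lra. }
set (a' := left_half G an sn cn (cn + tn)) in *.
destruct (lower_half_spec G a' (a' + sn / 2) cn tn) as [M1 [M2 M3]]; [lra|lra| |].
{ intros u v Hu Hv; apply HG; lra. }
repeat split; lra.
Qed.

Lemma pow_half_small (s d : R) : 0 <= s -> 0 < d -> exists n, s / 2 ^ n < d.
Proof.
intros Hs Hd.
destruct (Pow_x_infinity 2 ltac:(rewrite Rabs_right; lra) (s / d + 1)) as [N HN].
exists N; specialize (HN N (Nat.le_refl _)).
assert (P : 0 < 2 ^ N) by (apply pow_lt; lra).
rewrite Rabs_right in HN by lra.
apply Rlt_div_l; [lra|].
assert (s / d < 2 ^ N) by lra.
apply Rlt_div_l in H; [lra|easy].
Qed.

(** The nested rectangles share a point (p, q), where G is differentiable. On the n-th one the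
    remainder of the affine approximation is a small multiple of 2^-n, and the perimeter also
    shrinks like 2^-n; the product compensates the loss 4^n of the bisection. *)
Theorem goursat_rectangle (G : C -> C) (a b c d : R) :
  a <= b -> c <= d ->
  (forall u v, a <= u <= b -> c <= v <= d -> exists l, cderiv G (u, v) l) ->
  boundary_integral G a b c d = 0.
Proof.
intros Hab Hcd HG.
assert (HC : ccont_rect G a b c d).
{ intros u v Hu Hv; destruct (HG u v Hu Hv) as [l Hl]; exact (cderiv_ccont _ _ _ Hl). }
set (s := b - a); set (t := d - c).
assert (Hs : 0 <= s) by (unfold s; lra). assert (Ht : 0 <= t) by (unfold t; lra).
replace b with (a + s) in * by (unfold s; ring).
replace d with (c + t) in * by (unfold t; ring).
clearbody s t.
set (x := fun n => fst (bisect G a c s t n)); set (y := fun n => snd (bisect G a c s t n)).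
destruct (nested_halves x s Hs) as [p Hp].
{ intros n; pose proof (bisect_step G a c s t n Hs Ht HC) as H; unfold x.
  destruct (bisect G a c s t n), (bisect G a c s t (S n)); apply H. }
destruct (nested_halves y t Ht) as [q Hq].
{ intros n; pose proof (bisect_step G a c s t n Hs Ht HC) as H; unfold y.
  destruct (bisect G a c s t n), (bisect G a c s t (S n)); apply H. }
assert (Hpq : a <= p <= a + s /\ c <= q <= c + t).
{ pose proof (Hp 0%nat) as H1; pose proof (Hq 0%nat) as H2; unfold x, y in H1, H2; simpl in H1, H2.
  unfold Rdiv in H1, H2; rewrite Rinv_1, Rmult_1_r in H1, H2; lra. }
destruct Hpq as [Hpa Hqc].
destruct (HG p q Hpa Hqc) as [l Hl].
apply Cmod_eq_0, Rle_antisym; [|apply Cmod_ge_0].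
apply le_epsilon; intros eps Heps; rewrite Rplus_0_l.
(* The powers of 2 will cancel and leave 2 (s + t)^2 times the tolerance; the summand 1 keeps K
   positive for a degenerate rectangle. *)
set (K := 2 * ((s + t) * (s + t)) + 1).
assert (HK : 0 < K) by (unfold K; nra).
assert (He : 0 < eps / K) by now apply Rdiv_lt_0_compat.
destruct (Hl (eps / K) He) as [del [Hdel HL]].
destruct (pow_half_small (s + t) del) as [n Hn]; [lra|easy|].
pose proof (bisect_spec G a c s t n Hs Ht HC) as HB.
specialize (Hp n); specialize (Hq n); unfold x, y in Hp, Hq.
destruct (bisect G a c s t n) as [an cn]; simpl in Hp, Hq.
destruct HB as [B1 [B2 [B3 [B4 B5]]]].
assert (P : 0 < 2 ^ n) by (apply pow_lt; lra).
assert (Hsn : 0 <= s / 2 ^ n) by (apply Rle_div_r; lra).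
assert (Htn : 0 <= t / 2 ^ n) by (apply Rle_div_r; lra).
assert (Est : (s + t) / 2 ^ n = s / 2 ^ n + t / 2 ^ n) by (field; lra).
eapply Rle_trans; [apply B5|].
assert (HN := boundary_integral_near_affine G an (an + s / 2 ^ n) cn (cn + t / 2 ^ n)
  (G (p, q)) l (p, q) (eps / K * ((s + t) / 2 ^ n))).
assert (HN' : Cmod (boundary_integral G an (an + s / 2 ^ n) cn (cn + t / 2 ^ n))
  <= 2 * (eps / K * ((s + t) / 2 ^ n)) * ((s + t) / 2 ^ n)).
{ eapply Rle_trans; [apply HN|right; rewrite Est; ring]; try lra.
  - intros u v Hu Hv; apply HC; lra.
  - intros u v Hu Hv.
    assert (Hd : Cmod ((u, v) - (p, q)) <= (s + t) / 2 ^ n).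
    { eapply Rle_trans; [apply Cmod_le_abs|]; simpl. rewrite Est.
      apply Rplus_le_compat; apply Rabs_le; lra. }
    eapply Rle_trans; [apply HL; lra|]. apply Rmult_le_compat_l; lra. }
eapply Rle_trans; [apply Rmult_le_compat_l, HN'; apply pow_le; lra|].
replace (4 ^ n) with (2 ^ n * 2 ^ n) by (rewrite <- Rpow_mult_distr; f_equal; ring).
replace (2 ^ n * 2 ^ n * (2 * (eps / K * ((s + t) / 2 ^ n)) * ((s + t) / 2 ^ n)))
  with (eps / K * (2 * ((s + t) * (s + t)))) by (field; split; lra).
apply Rle_trans with (eps / K * K); [|right; field; lra].
apply Rmult_le_compat_l; [lra|unfold K; lra].
Qed.

End RectangleIntegrals.

(** * The mean value property and Cauchy's estimate *)

Section MeanValue.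
Local Open Scope R_scope.

Definition cexp (z : C) : C := (RtoC (exp (fst z)) * (cos (snd z), sin (snd z)))%C.

Lemma cexp_plus (z w : C) : cexp (z + w) = (cexp z * cexp w)%C.
Proof.
unfold cexp; destruct z as [u v], w as [u' v']; simpl.
rewrite exp_plus, cos_plus, sin_plus; unfold Cmult; simpl; f_equal; ring.
Qed.

Lemma Cmod_cexp (z : C) : Cmod (cexp z) = exp (fst z).
Proof.
unfold cexp; rewrite Cmod_mult, Cmod_R, Rabs_right by (left; apply exp_pos).
unfold Cmod; simpl.
replace (cos (snd z) * (cos (snd z) * 1) + sin (snd z) * (sin (snd z) * 1))
  with (Rsqr (sin (snd z)) + Rsqr (cos (snd z))) by (unfold Rsqr; ring).
rewrite sin2_cos2, sqrt_1; ring.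
Qed.

Lemma derivable_pt_lim_0_le (g : R -> R) (l eps : R) :
  derivable_pt_lim g 0 l -> 0 < eps ->
  exists d, 0 < d /\ forall h, Rabs h < d -> Rabs (g h - g 0 - l * h) <= eps * Rabs h.
Proof.
intros Hg Heps; destruct (Hg eps Heps) as [d Hd].
exists d; split; [apply cond_pos|]; intros h Hh.
destruct (Req_dec h 0) as [->|Hn].
- replace (g 0 - g 0 - l * 0) with 0 by ring. rewrite Rabs_R0; lra.
- specialize (Hd h Hn Hh); rewrite Rplus_0_l in Hd.
  replace (g h - g 0 - l * h) with (((g h - g 0) / h - l) * h) by (field; easy).
  rewrite Rabs_mult; apply Rmult_le_compat_r; [apply Rabs_pos|lra].
Qed.

Lemma cderiv_cexp_0 : cderiv cexp 0 1.
Proof.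
intros eps Heps.
(* The two components of the remainder are bounded by 3 e |x| and 4 e |x|, together less than 8 e
   |x|; e <= 1 gives |1 + h| <= 2 and |sin k| <= 2 |k|. *)
set (e := Rmin (eps / 8) 1).
assert (He : 0 < e) by (apply Rmin_pos; lra).
assert (He1 : e <= 1) by apply Rmin_r.
assert (He8 : 8 * e <= eps) by (pose proof (Rmin_l (eps / 8) 1); unfold e; lra).
destruct (derivable_pt_lim_0_le exp 1 e) as [d1 [Hd1 H1]]; [|easy|].
{ pose proof (derivable_pt_lim_exp 0) as H; now rewrite exp_0 in H. }
destruct (derivable_pt_lim_0_le cos 0 e) as [d2 [Hd2 H2]]; [|easy|].
{ pose proof (derivable_pt_lim_cos 0) as H; now rewrite sin_0, Ropp_0 in H. }
destruct (derivable_pt_lim_0_le sin 1 e) as [d3 [Hd3 H3]]; [|easy|].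
{ pose proof (derivable_pt_lim_sin 0) as H; now rewrite cos_0 in H. }
exists (Rmin e (Rmin d1 (Rmin d2 d3))); split; [repeat apply Rmin_pos; lra|].
intros x Hx; replace (x - 0)%C with x in * by ring.
pose proof (Rlt_le_trans _ _ _ Hx (Rmin_l _ _)) as X0.
pose proof (Rlt_le_trans _ _ _ Hx (Rmin_r _ _)) as X.
pose proof (Rlt_le_trans _ _ _ X (Rmin_l _ _)) as X1.
pose proof (Rlt_le_trans _ _ _ X (Rmin_r _ _)) as X'.
pose proof (Rlt_le_trans _ _ _ X' (Rmin_l _ _)) as X2.
pose proof (Rlt_le_trans _ _ _ X' (Rmin_r _ _)) as X3.
clear X X' Hx.
pose proof (Rmax_Cmod x) as HM.
assert (Hh : Rabs (fst x) <= Cmod x) by (eapply Rle_trans; [apply Rmax_l|apply HM]).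
assert (Hk : Rabs (snd x) <= Cmod x) by (eapply Rle_trans; [apply Rmax_r|apply HM]).
specialize (H1 (fst x) ltac:(lra)); specialize (H2 (snd x) ltac:(lra)).
specialize (H3 (snd x) ltac:(lra)).
rewrite exp_0 in H1; rewrite cos_0 in H2; rewrite sin_0 in H3.
destruct x as [h k]; cbn [fst snd] in *.
set (m := Cmod (h, k)) in *.
(* Regroups both components around the first-order remainders of exp, cos and sin at 0; the only
   other term, h sin k, is of second order. *)
assert (E : (cexp (h, k) - cexp 0 - 1 * (h, k))%C
  = (((exp h - 1 - 1 * h) * cos k + (cos k - 1 - 0 * k) * (1 + h))%R,
     ((exp h - 1 - 1 * h) * sin k + h * sin k + (sin k - 0 - 1 * k))%R)).
{ unfold cexp; simpl; rewrite exp_0, cos_0, sin_0.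
  unfold Cminus, Cplus, Copp, Cmult; simpl; f_equal; ring. }
rewrite E; clear E.
eapply Rle_trans; [apply Cmod_le_abs|].
assert (Pc : Rabs (cos k) <= 1) by (apply Rabs_le; apply COS_bound).
assert (Ps : Rabs (sin k) <= 1) by (apply Rabs_le; apply SIN_bound).
assert (Ps2 : Rabs (sin k) <= 2 * Rabs k).
{ replace (sin k) with ((sin k - 0 - 1 * k) + k) by ring.
  eapply Rle_trans; [apply Rabs_triang|].
  assert (e * Rabs k <= 1 * Rabs k) by (apply Rmult_le_compat_r; [apply Rabs_pos|lra]). lra. }
assert (Ph : Rabs (1 + h) <= 2).
{ eapply Rle_trans; [apply Rabs_triang|]. rewrite Rabs_R1; lra. }
assert (A1 : Rabs ((exp h - 1 - 1 * h) * cos k + (cos k - 1 - 0 * k) * (1 + h)) <= 3 * e * m).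
{ eapply Rle_trans; [apply Rabs_triang|]; rewrite !Rabs_mult.
  assert (Rabs (exp h - 1 - 1 * h) * Rabs (cos k) <= e * m * 1).
  { apply Rmult_le_compat; try apply Rabs_pos; [|easy].
    eapply Rle_trans; [apply H1|]; apply Rmult_le_compat_l; lra. }
  assert (Rabs (cos k - 1 - 0 * k) * Rabs (1 + h) <= e * m * 2).
  { apply Rmult_le_compat; try apply Rabs_pos; [|easy].
    eapply Rle_trans; [apply H2|]; apply Rmult_le_compat_l; lra. }
  lra. }
assert (A2 : Rabs ((exp h - 1 - 1 * h) * sin k + h * sin k + (sin k - 0 - 1 * k)) <= 4 * e * m).
{ eapply Rle_trans; [apply Rabs_triang|].
  eapply Rle_trans; [apply Rplus_le_compat_r, Rabs_triang|]; rewrite !Rabs_mult.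
  assert (Rabs (exp h - 1 - 1 * h) * Rabs (sin k) <= e * m * 1).
  { apply Rmult_le_compat; try apply Rabs_pos; [|easy].
    eapply Rle_trans; [apply H1|]; apply Rmult_le_compat_l; lra. }
  assert (Rabs h * Rabs (sin k) <= m * (2 * e)).
  { apply Rmult_le_compat; try apply Rabs_pos; lra. }
  assert (Rabs (sin k - 0 - 1 * k) <= e * m).
  { eapply Rle_trans; [apply H3|]; apply Rmult_le_compat_l; lra. }
  lra. }
assert (Pm : 0 <= m) by apply Cmod_ge_0.
assert (8 * e * m <= eps * m) by (apply Rmult_le_compat_r; lra).
assert (0 <= e * m) by (apply Rmult_le_pos; lra).
lra.
Qed.

(** The functional equation transports the derivative at 0 to z. *)
Lemma cderiv_cexp (z : C) : cderiv cexp z (cexp z).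
Proof.
apply (cderiv_ext_loc (fun x => cexp z * cexp (x - z))%C _ _ _ 1 Rlt_0_1).
{ intros x _; rewrite <- cexp_plus; f_equal; ring. }
assert (Ht : cderiv (fun x => x - z)%C z (1 - 0))
  by (apply cderiv_minus; [apply cderiv_id|apply cderiv_const]).
eapply cderiv_eq.
- apply cderiv_mult; [apply cderiv_const|].
  refine (cderiv_comp cexp (fun x => x - z)%C z 1 (1 - 0) _ Ht); cbv beta.
  replace (z - z)%C with (RtoC 0) by ring. apply cderiv_cexp_0.
- cbv beta; ring.
Qed.

Definition circ (c : C) (r v : R) : C := (c + RtoC r * (cos v, sin v))%C.

Lemma circ_cexp (c : C) (r v : R) : 0 < r -> circ c r v = (c + cexp (ln r, v))%C.
Proof. intros Hr; unfold circ, cexp; simpl; now rewrite exp_ln. Qed.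

Lemma Cmod_circ (c : C) (r v : R) : 0 < r -> Cmod (circ c r v - c) = r.
Proof.
intros Hr; rewrite circ_cexp by easy.
replace (c + cexp (ln r, v) - c)%C with (cexp (ln r, v)) by ring.
rewrite Cmod_cexp; now apply exp_ln.
Qed.

Lemma path_cont_circ (c : C) (r t : R) : 0 < r -> path_cont (circ c r) t.
Proof.
intros Hr.
assert (H : path_cont (fun v => c + cexp (ln r, v))%C t).
{ apply (path_cont_comp (fun z => c + cexp z)%C).
  - apply (cderiv_ccont _ _ (0 + cexp (ln r, t))).
    apply cderiv_plus; [apply cderiv_const|apply cderiv_cexp].
  - apply path_cont_vertical. }
intros eps Heps; destruct (H eps Heps) as [d [Hd HH]].
exists d; split; [easy|]; intros s Hs; rewrite !circ_cexp by easy; auto.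
Qed.

Lemma ex_RIntC_circ (F : C -> C) (c : C) (r : R) :
  0 < r -> (forall z, Cmod (z - c) = r -> ccont F z) ->
  ex_RIntC (fun v => F (circ c r v)) 0 (2 * PI).
Proof.
intros Hr H; pose proof PI_RGT_0.
apply ex_RIntC_path_cont; [lra|]; intros t _.
apply path_cont_comp; [apply H; now apply Cmod_circ|now apply path_cont_circ].
Qed.

(* In the logarithmic coordinate [w], with [z = c + e^w], the circles around [c] are the
   vertical sides of rectangles of height [2 pi], and the horizontal sides cancel. *)
Theorem mean_value_circle (F : C -> C) (c : C) (r : R) :
  0 < r -> (forall z, 0 < Cmod (z - c) <= r -> exists l, cderiv F z l) -> ccont F c ->
  RIntC (fun v => F (circ c r v)) 0 (2 * PI) = (RtoC (2 * PI) * F c)%C.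
Proof.
intros Hr HF Hc; pose proof PI_RGT_0 as HPI.
set (G := fun w => F (c + cexp w)%C).
assert (HG : forall u v, u <= ln r -> exists l, cderiv G (u, v) l).
{ intros u v Hu. destruct (HF (c + cexp (u, v))%C) as [l Hl].
  - replace (c + cexp (u, v) - c)%C with (cexp (u, v)) by ring.
    rewrite Cmod_cexp; simpl; split; [apply exp_pos|].
    rewrite <- (exp_ln r Hr). destruct (Rle_lt_or_eq_dec _ _ Hu) as [Hlt| ->]; [|lra].
    left; now apply exp_increasing.
  - exists (l * (0 + cexp (u, v)))%C.
    apply (cderiv_comp F (fun w => c + cexp w)%C); [easy|].
    apply cderiv_plus; [apply cderiv_const|apply cderiv_cexp]. }
assert (HGc : forall u, u <= ln r -> ex_RIntC (fun v => G (u, v)) 0 (2 * PI)).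
{ intros u Hu; apply ex_RIntC_vertical; [lra|]; intros v _.
  destruct (HG u v Hu) as [l Hl]; exact (cderiv_ccont _ _ _ Hl). }
assert (Heq : forall a, a <= ln r ->
  RIntC (fun v => G (ln r, v)) 0 (2 * PI) = RIntC (fun v => G (a, v)) 0 (2 * PI)).
{ intros a Ha.
  pose proof (goursat_rectangle G a (ln r) 0 (2 * PI) Ha ltac:(lra)
    ltac:(intros; apply HG; lra)) as HB.
  unfold boundary_integral in HB.
  rewrite (RIntC_ext _ (fun _ => RtoC 0)) in HB.
  - rewrite RIntC_const, RIntC_minus in HB by (apply HGc; lra).
    apply Ceq_minus; rewrite <- HB; ring.
  - intros u; unfold G, cexp; simpl.
    rewrite cos_2PI, sin_2PI, cos_0, sin_0; ring. }
rewrite (RIntC_ext _ (fun v => G (ln r, v)))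
  by (intros v; unfold G; now rewrite circ_cexp).
apply Ceq_minus, Cmod_eq_0, Rle_antisym; [|apply Cmod_ge_0].
apply le_epsilon; intros eps Heps; rewrite Rplus_0_l.
destruct (Hc (eps / (2 * PI))) as [d [Hd HH]]; [apply Rdiv_lt_0_compat; lra|].
(* With the left side at abscissa a, the inner circle has radius e^a <= d / 2, where F differs from
   F c by less than eps / (2 pi). *)
set (a := Rmin (ln r) (ln (d / 2))).
rewrite (Heq a) by apply Rmin_l.
replace (RtoC (2 * PI)) with (RtoC (2 * PI - 0)) by (f_equal; ring).
replace eps with ((2 * PI - 0) * (eps / (2 * PI))) by (field; lra).
apply RIntC_near_const; [lra|apply HGc, Rmin_l|].
intros t _; left; apply HH.
replace (c + cexp (a, t) - c)%C with (cexp (a, t)) by ring.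
rewrite Cmod_cexp; simpl.
apply Rle_lt_trans with (exp (ln (d / 2))); [|rewrite exp_ln; lra].
destruct (Rle_lt_or_eq_dec _ _ (Rmin_r (ln r) (ln (d / 2)))) as [Hlt|E].
- left; now apply exp_increasing.
- right; now rewrite <- E.
Qed.

(** A weak maximum principle. At the centre it asks for continuity only, so that it applies to
    reciprocals of difference quotients. *)
Lemma mean_value_Cmod_le (F : C -> C) (c : C) (r M : R) :
  0 < r -> (forall z, 0 < Cmod (z - c) <= r -> exists l, cderiv F z l) -> ccont F c ->
  (forall v, 0 <= v <= 2 * PI -> Cmod (F (circ c r v)) <= M) -> Cmod (F c) <= M.
Proof.
intros Hr HF Hc HM; pose proof PI_RGT_0 as HPI.
pose proof (mean_value_circle F c r Hr HF Hc) as E.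
assert (Hex : ex_RIntC (fun v => F (circ c r v)) 0 (2 * PI)).
{ apply ex_RIntC_circ; [easy|]; intros z Hz.
  destruct (HF z) as [l Hl]; [lra|exact (cderiv_ccont _ _ _ Hl)]. }
pose proof (Cmod_RIntC_le _ 0 (2 * PI) M ltac:(lra) Hex HM) as B.
rewrite E, Cmod_mult, Cmod_R, Rabs_right in B by lra.
apply Rmult_le_reg_l with (2 * PI); lra.
Qed.

(** The difference quotient with its singularity at c filled by l. When l is the derivative it is
    continuous at c, which is all that the mean value property requires there. *)
Definition slope (f : C -> C) (c l x : C) : C :=
  if Ceq_dec x c then l else ((f x - f c) / (x - c))%C.

Lemma slope_center (f : C -> C) (c l : C) : slope f c l c = l.
Proof. unfold slope; destruct (Ceq_dec c c); [easy|congruence]. Qed.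

Lemma slope_off_center (f : C -> C) (c l x : C) :
  0 < Cmod (x - c) -> slope f c l x = ((f x - f c) / (x - c))%C.
Proof.
intros Hx; unfold slope; destruct (Ceq_dec x c) as [E|_]; [|easy].
rewrite E, Cmod_self_minus in Hx; lra.
Qed.

Lemma ccont_slope (f : C -> C) (z l : C) : cderiv f z l -> ccont (slope f z l) z.
Proof.
intros H eps Heps.
destruct (H (eps / 2)) as [d [Hd HH]]; [lra|].
exists d; split; [easy|]; intros x Hx; rewrite slope_center; unfold slope.
destruct (Ceq_dec x z) as [->|Hn].
- now rewrite Cmod_self_minus.
- specialize (HH x Hx).
  pose proof (Cminus_eq_contra _ _ Hn) as Hn'.
  pose proof (proj1 (Cmod_gt_0 _) Hn') as Hp.
  replace ((f x - f z) / (x - z) - l)%C with ((f x - f z - l * (x - z)) / (x - z))%C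
    by (field; auto).
  rewrite Cmod_div by easy.
  apply Rle_lt_trans with (eps / 2); [|lra]. now apply Rle_div_l.
Qed.

Lemma cderiv_slope (f : C -> C) (c l z m : C) :
  0 < Cmod (z - c) -> cderiv f z m -> exists k, cderiv (slope f c l) z k.
Proof.
intros Hz Hm; eexists.
eapply (cderiv_ext_loc (fun x => (f x - f c) / (x - c))%C) with (d := Cmod (z - c)); [lra| |].
- intros x Hx; symmetry; apply slope_off_center.
  pose proof (Cmod_triangle_rev (z - c) (z - x)) as T.
  replace (z - c - (z - x))%C with (x - c)%C in T by ring.
  rewrite (Cmod_minus_sym z x) in T; lra.
- apply cderiv_div;
    [apply cderiv_minus; [apply Hm|apply cderiv_const]
    |apply cderiv_minus; [apply cderiv_id|apply cderiv_const]
    |apply Cmod_gt_0; lra].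
Qed.

(** The mean value property of the slope, whose value at the centre is the derivative. This is
    Cauchy's formula for F' at c, with F c subtracted from F. *)
Lemma cauchy_derivative_formula (F : C -> C) (c l : C) (r : R) :
  0 < r -> (forall z, Cmod (z - c) <= r -> exists l, cderiv F z l) -> cderiv F c l ->
  RIntC (fun v => (F (circ c r v) - F c) / (circ c r v - c))%C 0 (2 * PI)
  = (RtoC (2 * PI) * l)%C.
Proof.
intros Hr HF Hl.
rewrite (RIntC_ext _ (fun v => slope F c l (circ c r v))).
- rewrite mean_value_circle; [now rewrite slope_center|easy| |now apply ccont_slope].
  intros z Hz; destruct (HF z ltac:(lra)) as [m Hm]; apply (cderiv_slope F c l z m); lra || easy.
- intros v; rewrite slope_off_center; [easy|]; rewrite Cmod_circ; lra.
Qed.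

Lemma cauchy_estimate (F : C -> C) (c l : C) (r M : R) :
  0 < r -> (forall z, Cmod (z - c) <= r -> exists l, cderiv F z l) -> cderiv F c l ->
  (forall z, Cmod (z - c) = r -> Cmod (F z - F c) <= M) -> Cmod l <= M / r.
Proof.
intros Hr HF Hl HM; pose proof PI_RGT_0 as HPI.
pose proof (cauchy_derivative_formula F c l r Hr HF Hl) as E.
assert (Hex : ex_RIntC (fun v => (F (circ c r v) - F c) / (circ c r v - c))%C 0 (2 * PI)).
{ apply (ex_RIntC_circ (fun z => (F z - F c) / (z - c))%C); [easy|]; intros z Hz.
  destruct (HF z) as [m Hm]; [lra|].
  eapply cderiv_ccont, cderiv_div;
    [apply cderiv_minus; [apply Hm|apply cderiv_const]
    |apply cderiv_minus; [apply cderiv_id|apply cderiv_const]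
    |apply Cmod_gt_0; lra]. }
pose proof (Cmod_RIntC_le _ 0 (2 * PI) (M / r) ltac:(lra) Hex) as B.
rewrite E, Cmod_mult, Cmod_R, Rabs_right in B by lra.
apply Rmult_le_reg_l with (2 * PI); [lra|]. rewrite Rminus_0_r in B; apply B.
intros t _; rewrite Cmod_div, Cmod_circ by (try apply Cmod_gt_0; rewrite ?Cmod_circ; lra).
apply Rmult_le_compat_r; [left; now apply Rinv_0_lt_compat|apply HM, Cmod_circ, Hr].
Qed.

End MeanValue.

(** * Holomorphy of the derivative *)

Section HolomorphicDerivative.
Local Open Scope R_scope.

Lemma Cmod_segment_le (c x y : C) (t r : R) :
  Cmod (x - c) <= r -> Cmod (y - c) <= r -> 0 <= t <= 1 ->
  Cmod (x + t * (y - x) - c) <= r.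
Proof.
intros Hx Hy Ht.
replace (x + t * (y - x) - c)%C with (RtoC (1 - t) * (x - c) + RtoC t * (y - c))%C
  by (rewrite RtoC_minus; ring).
eapply Rle_trans; [apply Cmod_triangle|].
rewrite !Cmod_mult, !Cmod_R, !Rabs_right by lra. nra.
Qed.

Lemma ccont_mult (f g : C -> C) (z : C) :
  ccont f z -> ccont g z -> ccont (fun x => f x * g x)%C z.
Proof.
intros Hf Hg eps Heps.
pose proof (Cmod_ge_0 (f z)) as P1; pose proof (Cmod_ge_0 (g z)) as P2.
set (K := Cmod (f z) + Cmod (g z) + 1).
assert (HK : 0 < K) by (unfold K; lra).
assert (He : 0 < eps / (2 * K)) by (apply Rdiv_lt_0_compat; lra).
set (e := Rmin 1 (eps / (2 * K))).
assert (He0 : 0 < e) by (apply Rmin_pos; lra).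
assert (He1 : e <= 1) by apply Rmin_l.
assert (HeK : e * K < eps).
{ apply Rle_lt_trans with (eps / (2 * K) * K);
    [|replace (eps / (2 * K) * K) with (eps / 2) by (field; lra); lra].
  apply Rmult_le_compat_r; [lra|apply Rmin_r]. }
destruct (Hf e He0) as [d1 [Hd1 H1]].
destruct (Hg e He0) as [d2 [Hd2 H2]].
exists (Rmin d1 d2); split; [now apply Rmin_pos|]; intros x Hx.
specialize (H1 x (Rlt_le_trans _ _ _ Hx (Rmin_l _ _))).
specialize (H2 x (Rlt_le_trans _ _ _ Hx (Rmin_r _ _))).
replace (f x * g x - f z * g z)%C with ((f x - f z) * g x + f z * (g x - g z))%C by ring.
eapply Rle_lt_trans; [apply Cmod_triangle|]; rewrite !Cmod_mult.
assert (Hgx : Cmod (g x) <= Cmod (g z) + 1) by (pose proof (Cmod_triangle_rev (g x) (g z)); lra).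
assert (Cmod (f x - f z) * Cmod (g x) <= e * (Cmod (g z) + 1))
  by (apply Rmult_le_compat; try apply Cmod_ge_0; lra).
assert (Cmod (f z) * Cmod (g x - g z) <= Cmod (f z) * e) by (apply Rmult_le_compat_l; lra).
unfold K in HeK; lra.
Qed.

Lemma cderiv_shift (f : C -> C) (h z l : C) :
  cderiv f (z + h)%C l -> cderiv (fun x => f (x + h)%C) z l.
Proof.
intros H; eapply cderiv_eq.
- apply (cderiv_comp f (fun x => x + h)%C z l (1 + 0)%C H).
  apply cderiv_plus; [apply cderiv_id|apply cderiv_const].
- ring.
Qed.

(** Continuity bounds the oscillation of f near c, Cauchy's estimate on circles of a fixed radius
    turns this into a bound for f', and the mean value inequality does the rest. *)
Lemma holomorphic_locally_lipschitz (f f' : C -> C) (c : C) (R0 : R) :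
  0 < R0 -> (forall z, Cmod (z - c) < R0 -> cderiv f z (f' z)) ->
  exists r K, 0 < r < R0 /\ 0 <= K /\
    forall x y, Cmod (x - c) <= r -> Cmod (y - c) <= r ->
      Cmod (f y - f x) <= K * Cmod (y - x).
Proof.
intros HR Hf.
assert (Hc : ccont f c).
{ apply (cderiv_ccont _ _ (f' c)), Hf; rewrite Cmod_self_minus; lra. }
destruct (Hc 1 Rlt_0_1) as [d [Hd HH]].
(* A circle of radius r about a point at distance at most r from c stays within 2 r of c, strictly
   inside both disks. There two values of f differ by at most 2, hence the bound 2 / r. *)
set (r := Rmin d R0 / 3).
assert (Hm : 0 < Rmin d R0) by now apply Rmin_pos.
assert (H1 : 3 * r <= d) by (pose proof (Rmin_l d R0); unfold r; lra).
assert (H2 : 3 * r <= R0) by (pose proof (Rmin_r d R0); unfold r; lra).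
assert (Hr : 0 < r) by (unfold r; lra).
assert (HK : 0 <= 2 / r) by (apply Rle_div_r; lra).
exists r, (2 / r); split; [lra|]; split; [easy|].
assert (Hb : forall z, Cmod (z - c) <= r -> Cmod (f' z) <= 2 / r).
{ intros z Hz.
  assert (Hin : forall x, Cmod (x - z) <= r -> Cmod (x - c) < d /\ Cmod (x - c) < R0).
  { intros x Hx; pose proof (Cmod_minus_triangle x z c); lra. }
  apply (cauchy_estimate f z); [easy| |apply Hf; lra|].
  - intros x Hx; exists (f' x); apply Hf, Hin, Hx.
  - intros x Hx.
    pose proof (HH x (proj1 (Hin x (Req_le _ _ Hx)))).
    pose proof (HH z ltac:(lra)) as Hfz; rewrite Cmod_minus_sym in Hfz.
    pose proof (Cmod_minus_triangle (f x) (f c) (f z)); lra. }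
intros x y Hx Hy; apply (cderiv_mean_value_le f f').
- intros t Ht; apply Hf; pose proof (Cmod_segment_le c x y t r Hx Hy Ht); lra.
- intros t Ht; apply Hb, Cmod_segment_le; assumption.
Qed.

(** Cauchy's estimate is applied to the increment u -> f (u + h) - f u with h = y - x: its values
    are at most K |h|, and its derivative at x is f' y - f' x. *)
Lemma derivative_locally_lipschitz (f f' : C -> C) (c : C) (R0 : R) :
  0 < R0 -> (forall z, Cmod (z - c) < R0 -> cderiv f z (f' z)) ->
  exists r L, 0 < r < R0 /\ 0 <= L /\
    forall x y, Cmod (x - c) <= r -> Cmod (y - c) <= r ->
      Cmod (f' y - f' x) <= L * Cmod (y - x).
Proof.
intros HR Hf.
destruct (holomorphic_locally_lipschitz f f' c R0 HR Hf) as [r [K [Hr [HK HL]]]].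
exists (r / 2), (2 * K / (r / 2)).
assert (HL0 : 0 <= 2 * K / (r / 2)) by (apply Rle_div_r; lra).
split; [lra|]; split; [easy|]; intros x y Hx Hy.
set (h := (y - x)%C).
assert (Hin : forall z, Cmod (z - x) <= r / 2 -> Cmod (z - c) <= r /\ Cmod (z + h - c) <= r).
{ intros z Hz; split.
  - pose proof (Cmod_minus_triangle z x c); lra.
  - pose proof (Cmod_triangle (z - x) (y - c)).
    replace (z + h - c)%C with (z - x + (y - c))%C by (unfold h; ring); lra. }
assert (HD : forall z, Cmod (z - x) <= r / 2 ->
  cderiv (fun u => f (u + h) - f u)%C z (f' (z + h) - f' z)%C).
{ intros z Hz; destruct (Hin z Hz); apply cderiv_minus; [apply cderiv_shift|]; apply Hf; lra. }
replace (2 * K / (r / 2) * Cmod h) with (2 * K * Cmod h / (r / 2)) by (field; lra).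
replace y with (x + h)%C by (unfold h; ring).
apply (cauchy_estimate (fun u => f (u + h) - f u)%C x); [lra| | |].
- intros z Hz; eexists; now apply HD.
- apply HD; rewrite Cmod_self_minus; lra.
- intros z Hz.
  destruct (Hin z ltac:(lra)) as [A1 A2].
  destruct (Hin x ltac:(rewrite Cmod_self_minus; lra)) as [A3 A4].
  eapply Rle_trans; [apply Cmod_triangle|]; rewrite Cmod_opp.
  pose proof (HL _ _ A1 A2) as B1; pose proof (HL _ _ A3 A4) as B2.
  replace (z + h - z)%C with h in B1 by ring; replace (x + h - x)%C with h in B2 by ring.
  lra.
Qed.

(** The mean value inequality for z -> f z - z f' x, whose derivative f' z - f' x is at most L |y -
    x| on the segment. *)
Lemma cderiv_second_order (f f' : C -> C) (c : C) (r L : R) :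
  0 <= L ->
  (forall z, Cmod (z - c) <= r -> cderiv f z (f' z)) ->
  (forall x y, Cmod (x - c) <= r -> Cmod (y - c) <= r ->
      Cmod (f' y - f' x) <= L * Cmod (y - x)) ->
  forall x y, Cmod (x - c) <= r -> Cmod (y - c) <= r ->
    Cmod (f y - f x - (y - x) * f' x) <= L * Cmod (y - x) * Cmod (y - x).
Proof.
intros HL0 Hf HL x y Hx Hy.
replace (f y - f x - (y - x) * f' x)%C with ((f y - y * f' x) - (f x - x * f' x))%C by ring.
apply (cderiv_mean_value_le (fun z => f z - z * f' x)%C (fun z => f' z - f' x)%C).
- intros t Ht; eapply cderiv_eq.
  + apply cderiv_minus; [apply Hf, Cmod_segment_le; assumption|].
    apply cderiv_mult; [apply cderiv_id|apply cderiv_const].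
  + cbv beta; ring.
- intros t Ht.
  eapply Rle_trans; [apply HL; [easy|now apply Cmod_segment_le]|].
  apply Rmult_le_compat_l; [easy|].
  replace (x + t * (y - x) - x)%C with (RtoC t * (y - x))%C by ring.
  rewrite Cmod_mult, Cmod_R, Rabs_right by lra.
  pose proof (Cmod_ge_0 (y - x)); nra.
Qed.

(* The derivative of [f'] is obtained by differentiating Cauchy's formula for [f'] under the integral. *)
Theorem holomorphic_derivative (f f' : C -> C) (c : C) (R0 : R) :
  0 < R0 -> (forall z, Cmod (z - c) < R0 -> cderiv f z (f' z)) ->
  exists l, cderiv f' c l.
Proof.
intros HR Hf; pose proof PI_RGT_0 as HPI.
destruct (derivative_locally_lipschitz f f' c R0 HR Hf) as [r [L [Hr [HL HLip]]]].
pose proof (cderiv_second_order f f' c r L HL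
  ltac:(intros; apply Hf; lra) HLip) as H2.
set (q := r / 2).
assert (Hq : 0 < q) by (unfold q; lra).
assert (Hcc : forall z, Cmod (z - c) < r -> ccont f' z).
{ intros z Hz eps Heps.
  assert (He : 0 < eps / (L + 1)) by (apply Rdiv_lt_0_compat; lra).
  exists (Rmin (r - Cmod (z - c)) (eps / (L + 1))); split; [apply Rmin_pos; lra|]; intros x Hx.
  pose proof (Rlt_le_trans _ _ _ Hx (Rmin_l _ _)) as X1.
  pose proof (Rlt_le_trans _ _ _ Hx (Rmin_r _ _)) as X2.
  pose proof (Cmod_minus_triangle x z c).
  eapply Rle_lt_trans; [apply HLip; lra|].
  apply Rle_lt_trans with ((L + 1) * Cmod (x - z)); [pose proof (Cmod_ge_0 (x - z)); lra|].
  apply Rlt_le_trans with ((L + 1) * (eps / (L + 1))); [|right; field; lra].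
  apply Rmult_lt_compat_l; lra. }
(* Cauchy's integral with f' in place of f: S / (2 pi) is the candidate for the second
   derivative. *)
set (S := RIntC (fun v => (f' (circ c q v) - f' c) / (circ c q v - c))%C 0 (2 * PI)).
assert (HexS : ex_RIntC (fun v => (f' (circ c q v) - f' c) / (circ c q v - c))%C 0 (2 * PI)).
{ apply (ex_RIntC_circ (fun z => (f' z - f' c) * / (z - c))%C); [easy|]; intros z Hz.
  apply ccont_mult.
  - intros eps Heps; destruct (Hcc z ltac:(unfold q in Hz; lra) eps Heps) as [d [Hd HH]].
    exists d; split; [easy|]; intros x Hx.
    replace (f' x - f' c - (f' z - f' c))%C with (f' x - f' z)%C by ring; auto.
  - eapply cderiv_ccont, cderiv_inv.
    + apply cderiv_minus; [apply cderiv_id|apply cderiv_const].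
    + apply Cmod_gt_0; lra. }
exists (S / RtoC (2 * PI))%C.
assert (HPIC : RtoC (2 * PI) <> 0) by (intros E; apply RtoC_inj in E; lra).
intros eps Heps.
(* The final error is (2 L / q) |h|^2; the summand 1 makes M positive when L = 0. *)
set (M := 2 * L / q + 1).
assert (HM : 0 < M) by (assert (0 <= 2 * L / q) by (apply Rle_div_r; lra); unfold M; lra).
exists (Rmin q (eps / M)); split; [apply Rmin_pos; [lra|now apply Rdiv_lt_0_compat]|].
intros x Hx.
pose proof (Rlt_le_trans _ _ _ Hx (Rmin_l _ _)) as X1.
pose proof (Rlt_le_trans _ _ _ Hx (Rmin_r _ _)) as X2.
set (h := (x - c)%C) in *; replace x with (c + h)%C by (unfold h; ring).
pose proof (Cmod_ge_0 h) as Ph.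
(* Cauchy's formula for the increment E represents f' (c + h) - f' c, and E differs from h f' by at
   most L |h|^2 uniformly on the circle. *)
set (E := fun z => (f (z + h) - f z)%C).
assert (Hin : forall z, Cmod (z - c) <= q -> Cmod (z - c) <= r /\ Cmod (z + h - c) <= r).
{ intros z Hz; split; [unfold q in Hz; lra|].
  pose proof (Cmod_triangle (z - c) h).
  replace (z + h - c)%C with (z - c + h)%C by ring; unfold q in *; lra. }
assert (HE : forall z, Cmod (z - c) <= q -> cderiv E z (f' (z + h) - f' z)%C).
{ intros z Hz; destruct (Hin z Hz); apply cderiv_minus; [apply cderiv_shift|]; apply Hf; lra. }
assert (HE2 : forall z, Cmod (z - c) <= q -> Cmod (E z - h * f' z) <= L * Cmod h * Cmod h).
{ intros z Hz; destruct (Hin z Hz) as [A1 A2].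
  pose proof (H2 z (z + h)%C A1 A2) as B; replace (z + h - z)%C with h in B by ring; exact B. }
assert (Hc0 : Cmod (c - c) <= q) by (rewrite Cmod_self_minus; lra).
assert (Hex : ex_RIntC (fun v => (E (circ c q v) - E c) / (circ c q v - c))%C 0 (2 * PI)).
{ apply (ex_RIntC_circ (fun z => (E z - E c) / (z - c))%C); [easy|]; intros z Hz.
  eapply cderiv_ccont, cderiv_div;
    [apply cderiv_minus; [apply HE; lra|apply cderiv_const]
    |apply cderiv_minus; [apply cderiv_id|apply cderiv_const]
    |apply Cmod_gt_0; lra]. }
pose proof (cauchy_derivative_formula E c _ q Hq
  ltac:(intros z Hz; eexists; now apply HE) (HE c Hc0)) as HF.
assert (HS : (RtoC (2 * PI) * (f' (c + h) - f' c - S / RtoC (2 * PI) * h)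
  = RIntC (fun v => (E (circ c q v) - E c) / (circ c q v - c)
                    - h * ((f' (circ c q v) - f' c) / (circ c q v - c))) 0 (2 * PI))%C).
{ rewrite RIntC_minus, RIntC_Cmult, HF by auto using ex_RIntC_Cmult.
  fold S; now field. }
assert (HB : Cmod (RtoC (2 * PI) * (f' (c + h)%C - f' c - S / RtoC (2 * PI) * h))
  <= (2 * PI - 0) * (2 * (L * Cmod h * Cmod h) / q)).
{ rewrite HS; apply Cmod_RIntC_le; [lra|auto using ex_RIntC_minus, ex_RIntC_Cmult|].
  intros t _.
  assert (Hz : Cmod (circ c q t - c) = q) by now apply Cmod_circ.
  assert (Hz0 : (circ c q t - c)%C <> 0) by (apply Cmod_gt_0; lra).
  set (z := circ c q t) in *.
  replace ((E z - E c) / (z - c) - h * ((f' z - f' c) / (z - c)))%C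
    with (((E z - h * f' z) - (E c - h * f' c)) / (z - c))%C by (field; auto).
  rewrite Cmod_div, Hz by easy.
  apply Rmult_le_compat_r; [left; now apply Rinv_0_lt_compat|].
  eapply Rle_trans; [apply Cmod_triangle|]; rewrite Cmod_opp.
  pose proof (HE2 z (Req_le _ _ Hz)); pose proof (HE2 c Hc0); lra. }
rewrite Cmod_mult, Cmod_R, Rabs_right, Rminus_0_r in HB by lra.
apply Rmult_le_reg_l in HB; [|lra].
replace (c + h - c)%C with h by ring.
eapply Rle_trans; [apply HB|].
replace (2 * (L * Cmod h * Cmod h) / q) with (2 * L / q * Cmod h * Cmod h) by (field; lra).
apply Rmult_le_compat_r; [easy|].
apply Rle_trans with (M * Cmod h); [unfold M; nra|].
apply Rlt_div_r in X2; lra.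
Qed.

End HolomorphicDerivative.

(** * Injective holomorphic functions *)

Section UnivalentFunctions.
Local Open Scope R_scope.

(** By compactness the distance to f c attains its minimum on the circle, and this minimum is not
    0. *)
Lemma circle_separation (f : C -> C) (c : C) (r : R) :
  0 < r -> (forall z, Cmod (z - c) = r -> ccont f z) ->
  (forall z, Cmod (z - c) = r -> f z <> f c) ->
  exists m, 0 < m /\ forall v, 0 <= v <= 2 * PI -> m <= Cmod (f (circ c r v) - f c).
Proof.
intros Hr Hf Hn; pose proof PI_RGT_0 as HPI.
destruct (continuity_ab_min (fun v => Cmod (f (circ c r v) - f c)) 0 (2 * PI)) as [v0 [Hv0 _]];
  [lra| |].
- intros t _ eps Heps.
  destruct (path_cont_comp f (circ c r) t (Hf _ (Cmod_circ c r t Hr))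
    (path_cont_circ c r t Hr) eps Heps) as [d [Hd HH]].
  exists d; split; [easy|]; intros s [_ Hs]; specialize (HH s Hs).
  change (Rabs (Cmod (f (circ c r s) - f c) - Cmod (f (circ c r t) - f c)) < eps).
  pose proof (Cmod_triangle_rev (f (circ c r s) - f c) (f (circ c r t) - f c)) as T1.
  pose proof (Cmod_triangle_rev (f (circ c r t) - f c) (f (circ c r s) - f c)) as T2.
  replace (f (circ c r s) - f c - (f (circ c r t) - f c))%C
    with (f (circ c r s) - f (circ c r t))%C in T1 by ring.
  replace (f (circ c r t) - f c - (f (circ c r s) - f c))%C
    with (f (circ c r t) - f (circ c r s))%C in T2 by ring.
  rewrite (Cmod_minus_sym (f (circ c r t)) (f (circ c r s))) in T2.
  apply Rabs_def1; lra.
- exists (Cmod (f (circ c r v0) - f c)); split; [|exact Hv0].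
  apply Cmod_gt_0, Cminus_eq_contra, Hn, Cmod_circ, Hr.
Qed.

(* If [f] omitted a value [w] close to [f c], then [1 / (f - w)] would violate the mean value
   inequality at [c]. *)
Lemma open_mapping_at (f : C -> C) (c : C) (r : R) :
  0 < r -> (forall z, Cmod (z - c) <= r -> exists l, cderiv f z l) ->
  (forall z, Cmod (z - c) = r -> f z <> f c) ->
  exists d, 0 < d /\ forall w, Cmod (w - f c) < d -> exists z, Cmod (z - c) <= r /\ f z = w.
Proof.
intros Hr Hf Hn.
destruct (circle_separation f c r Hr) as [m [Hm Hsep]]; [|easy|].
{ intros z Hz; destruct (Hf z) as [l Hl]; [lra|exact (cderiv_ccont _ _ _ Hl)]. }
(* For such w, |f - w| >= m / 2 on the circle but |f c - w| < m / 2 at the centre, so the reciprocal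
   would be larger at the centre than its bound on the circle. *)
exists (m / 2); split; [lra|]; intros w Hw.
apply NNPP; intros Hno.
assert (Hne : forall z, Cmod (z - c) <= r -> (f z - w)%C <> 0).
{ intros z Hz E; apply Hno; exists z; split; [easy|now apply Ceq_minus]. }
assert (Hd : forall z, Cmod (z - c) <= r -> exists l, cderiv (fun x => / (f x - w))%C z l).
{ intros z Hz; destruct (Hf z Hz) as [l Hl]; eexists; apply cderiv_inv.
  - apply cderiv_minus; [apply Hl|apply cderiv_const].
  - now apply Hne. }
assert (Hcc : Cmod (c - c) <= r) by (rewrite Cmod_self_minus; lra).
assert (B : Cmod (/ (f c - w)) <= / (m / 2)).
{ apply (mean_value_Cmod_le (fun x => / (f x - w))%C c r); [easy| | |].
  - intros z Hz; apply Hd; lra.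
  - destruct (Hd c Hcc) as [l Hl]; exact (cderiv_ccont _ _ _ Hl).
  - intros v Hv.
    rewrite Cmod_inv by (apply Hne; rewrite Cmod_circ; lra).
    apply Rinv_le_contravar; [lra|].
    specialize (Hsep v Hv).
    pose proof (Cmod_minus_triangle (f (circ c r v)) w (f c)); lra. }
rewrite Cmod_inv in B by now apply Hne.
pose proof (proj1 (Cmod_gt_0 _) (Hne c Hcc)) as P.
rewrite Cmod_minus_sym in Hw.
apply Rinv_lt_contravar in Hw; [lra|]. apply Rmult_lt_0_compat; lra.
Qed.

Lemma ccont_comp (f g : C -> C) (z : C) :
  ccont f (g z) -> ccont g z -> ccont (fun x => f (g x)) z.
Proof.
intros Hf Hg eps Heps.
destruct (Hf eps Heps) as [d [Hd HH]]; destruct (Hg d Hd) as [d' [Hd' HH']].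
exists d'; split; auto.
Qed.

(* The mean value inequality for [(z - a) / (f z - f a)] bounds [1 / f' a]
   by the distortion of [f] on a circle around [a]. *)
Lemma univalent_derivative_lower_bound (f : C -> C) (a l : C) (r m : R) :
  0 < r -> 0 < m ->
  (forall z, Cmod (z - a) <= r -> exists k, cderiv f z k) ->
  (forall z, 0 < Cmod (z - a) <= r -> f z <> f a) ->
  (forall v, 0 <= v <= 2 * PI -> m <= Cmod (f (circ a r v) - f a)) ->
  cderiv f a l -> l <> 0 -> m / r <= Cmod l.
Proof.
intros Hr Hm Hf Hinj Hsep Hl Hl0.
assert (Hne : forall z, 0 < Cmod (z - a) <= r -> slope f a l z <> 0).
{ intros z Hz; rewrite slope_off_center by lra.
  unfold Cdiv; apply Cmult_neq_0.
  - now apply Cminus_eq_contra, Hinj.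
  - apply Cmod_gt_0; rewrite Cmod_inv by (apply Cmod_gt_0; lra).
    apply Rinv_0_lt_compat; lra. }
assert (B : Cmod (/ slope f a l a) <= r / m).
{ apply (mean_value_Cmod_le (fun z => / slope f a l z)%C a r); [easy| | |].
  - intros z Hz; destruct (Hf z ltac:(lra)) as [k Hk].
    destruct (cderiv_slope f a l z k ltac:(lra) Hk) as [k' Hk'].
    eexists; apply cderiv_inv; [apply Hk'|now apply Hne].
  - apply (ccont_comp Cinv (slope f a l)); [|now apply ccont_slope].
    rewrite slope_center; eapply cderiv_ccont, cderiv_Cinv, Hl0.
  - intros v Hv.
    assert (Hz : Cmod (circ a r v - a) = r) by now apply Cmod_circ.
    rewrite Cmod_inv by (apply Hne; lra).
    rewrite slope_off_center by lra.
    rewrite Cmod_div, Hz by (apply Cmod_gt_0; lra).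
    specialize (Hsep v Hv).
    rewrite Rinv_div; apply Rmult_le_compat_l; [lra|]. apply Rinv_le_contravar; lra. }
rewrite slope_center, Cmod_inv in B by easy.
pose proof (proj1 (Cmod_gt_0 _) Hl0) as P.
apply Rinv_le_contravar in B; [|now apply Rinv_0_lt_compat].
now rewrite Rinv_inv, Rinv_div in B.
Qed.

(** Near c the lower bound for nonzero values of f' is uniform. If f' c = 0, continuity of f' pushes
    |f'| below that bound, so f' vanishes on a whole disk about c; then f is constant there, against
    injectivity. *)
Theorem univalent_derivative_neq_0 (f f' : C -> C) (c : C) (R0 : R) :
  0 < R0 -> (forall z, Cmod (z - c) < R0 -> cderiv f z (f' z)) ->
  (forall x y, Cmod (x - c) < R0 -> Cmod (y - c) < R0 -> f x = f y -> x = y) ->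
  f' c <> 0.
Proof.
intros HR Hf Hinj H0; pose proof PI_RGT_0 as HPI.
destruct (holomorphic_locally_lipschitz f f' c R0 HR Hf) as [r1 [K [Hr1 [HK HL]]]].
set (r := r1 / 2). assert (Hr : 0 < r) by (unfold r; lra).
assert (Hneq : forall x y, Cmod (x - c) < R0 -> Cmod (y - c) < R0 -> 0 < Cmod (x - y) -> f x <> f y).
{ intros x y Hx Hy Hxy E; apply (Hinj x y Hx Hy) in E; subst.
  rewrite Cmod_self_minus in Hxy; lra. }
assert (Hcc : Cmod (c - c) < R0) by (rewrite Cmod_self_minus; lra).
destruct (circle_separation f c r Hr) as [m [Hm Hsep]].
{ intros z Hz; eapply cderiv_ccont, Hf; unfold r in *; lra. }
{ intros z Hz; apply Hneq; unfold r in *; lra. }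
assert (Hmr : 0 < m / 2 / r) by (apply Rdiv_lt_0_compat; lra).
assert (HmK : 0 < m / (4 * (K + 1))) by (apply Rdiv_lt_0_compat; lra).
destruct (holomorphic_derivative f f' c R0 HR Hf) as [l2 Hl2].
destruct (cderiv_ccont _ _ _ Hl2 (m / 2 / r) Hmr) as [d [Hd Hcd]].
(* The third entry gives K |a - c| <= m / 4. Moving both the circle and its centre from c to a thus
   costs at most m / 2 of the separation m. *)
set (e := Rmin d (Rmin r (m / (4 * (K + 1))))).
assert (He : 0 < e) by (repeat apply Rmin_pos; lra).
assert (He1 : e <= d) by apply Rmin_l.
assert (He2 : e <= r) by (eapply Rle_trans; [apply Rmin_r|apply Rmin_l]).
assert (He3 : e <= m / (4 * (K + 1))) by (eapply Rle_trans; [apply Rmin_r|apply Rmin_r]).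
assert (Hz : forall a, Cmod (a - c) < e -> Cmod (f' a) <= 0).
{ intros a Ha.
  destruct (Ceq_dec (f' a) 0) as [E|Hn]; [rewrite E, Cmod_0; lra|exfalso].
  assert (Hin : forall z, Cmod (z - a) <= r -> Cmod (z - c) <= r1).
  { intros z Hz; pose proof (Cmod_minus_triangle z a c); unfold r in *; lra. }
  assert (B : m / 2 / r <= Cmod (f' a)).
  { apply (univalent_derivative_lower_bound f a); [easy|lra| | | |apply Hf; unfold r in *; lra|easy].
    - intros z Hz; exists (f' z); apply Hf; specialize (Hin z Hz); lra.
    - intros z Hz; apply Hneq; [specialize (Hin z ltac:(lra)); lra|unfold r in *; lra|lra].
    - intros v Hv; specialize (Hsep v Hv).
      assert (E : (circ a r v - circ c r v = a - c)%C) by (unfold circ; ring).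
      assert (L1 : Cmod (f (circ c r v) - f (circ a r v)) <= K * Cmod (circ c r v - circ a r v)).
      { apply HL; [apply Hin; rewrite Cmod_circ; lra|rewrite Cmod_circ; unfold r; lra]. }
      rewrite (Cmod_minus_sym (circ c r v)), E in L1.
      assert (L2 : Cmod (f a - f c) <= K * Cmod (a - c)).
      { apply HL; [rewrite Cmod_self_minus; lra|unfold r in *; lra]. }
      pose proof (Cmod_minus_triangle (f (circ c r v)) (f (circ a r v)) (f c)) as T1.
      pose proof (Cmod_minus_triangle (f (circ a r v)) (f a) (f c)) as T2.
      assert (HKa : K * Cmod (a - c) <= m / 4).
      { apply Rle_trans with ((K + 1) * (m / (4 * (K + 1)))); [|right; field; lra].
        apply Rmult_le_compat; try lra; apply Cmod_ge_0. }
      lra. }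
  specialize (Hcd a ltac:(lra)); rewrite H0 in Hcd.
  replace (f' a - 0)%C with (f' a) in Hcd by ring; lra. }
set (y := (c + RtoC (e / 2))%C).
assert (Hy : Cmod (y - c) = e / 2).
{ unfold y; replace (c + RtoC (e / 2) - c)%C with (RtoC (e / 2)) by ring.
  rewrite Cmod_R, Rabs_right; lra. }
assert (Hseg : forall t, 0 <= t <= 1 -> Cmod (c + t * (y - c) - c) < e).
{ intros t Ht; apply Rle_lt_trans with (e / 2); [|lra].
  apply Cmod_segment_le; [rewrite Cmod_self_minus; lra|lra|easy]. }
assert (B : Cmod (f y - f c) <= 0 * Cmod (y - c)).
{ apply (cderiv_mean_value_le f f').
  - intros t Ht; apply Hf; specialize (Hseg t Ht); unfold r in *; lra.
  - intros t Ht; apply Hz, Hseg, Ht. }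
apply (Hneq y c); [unfold r in *; lra|lra|lra|].
apply Ceq_minus, Cmod_eq_0; pose proof (Cmod_ge_0 (f y - f c)); lra.
Qed.

Lemma cderiv_inverse (f g : C -> C) (z l : C) (d : R) :
  cderiv f z l -> l <> 0 -> g (f z) = z -> 0 < d ->
  (forall w, Cmod (w - f z) < d -> f (g w) = w) -> ccont g (f z) ->
  cderiv g (f z) (/ l).
Proof.
intros Hf Hl Hgz Hd Hfg Hg eps Heps.
pose proof (proj1 (Cmod_gt_0 _) Hl) as Pl.
(* With x and y the increments of g and of its argument, the first entry yields |y| >= |l| |x| / 2,
   and the second then turns e |x| / |l| into at most eps |y|. *)
set (e := Rmin (Cmod l / 2) (eps * (Cmod l * Cmod l) / 2)).
assert (Q : 0 < eps * (Cmod l * Cmod l)) by (repeat apply Rmult_lt_0_compat; lra).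
assert (He : 0 < e) by (apply Rmin_pos; lra).
assert (He1 : e <= Cmod l / 2) by apply Rmin_l.
assert (He2 : e <= eps * (Cmod l * Cmod l) / 2) by apply Rmin_r.
destruct (Hf e He) as [d1 [Hd1 H1]].
destruct (Hg d1 Hd1) as [d2 [Hd2 H2]].
exists (Rmin d d2); split; [now apply Rmin_pos|]; intros w Hw.
specialize (Hfg w (Rlt_le_trans _ _ _ Hw (Rmin_l _ _))).
specialize (H2 w (Rlt_le_trans _ _ _ Hw (Rmin_r _ _))).
rewrite Hgz in *.
specialize (H1 (g w) H2).
rewrite Hfg in H1.
set (x := (g w - z)%C) in *; set (y := (w - f z)%C) in *.
replace (x - / l * y)%C with (- ((y - l * x) / l))%C by (field; auto).
rewrite Cmod_opp, Cmod_div by easy.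
assert (Hy : Cmod l / 2 * Cmod x <= Cmod y).
{ pose proof (Cmod_triangle_rev (l * x) (l * x - y)) as T.
  replace (l * x - (l * x - y))%C with y in T by ring.
  rewrite (Cmod_minus_sym (l * x) y), Cmod_mult in T.
  assert (e * Cmod x <= Cmod l / 2 * Cmod x) by (apply Rmult_le_compat_r; [apply Cmod_ge_0|lra]).
  lra. }
apply Rle_div_l; [lra|].
eapply Rle_trans; [apply H1|].
apply Rle_trans with (eps * (Cmod l * Cmod l) / 2 * Cmod x);
  [apply Rmult_le_compat_r; [apply Cmod_ge_0|lra]|].
replace (eps * (Cmod l * Cmod l) / 2 * Cmod x) with (eps * Cmod l * (Cmod l / 2 * Cmod x)) by field.
replace (eps * Cmod y * Cmod l) with (eps * Cmod l * Cmod y) by ring.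
apply Rmult_le_compat_l; [apply Rmult_le_pos; lra|easy].
Qed.

End UnivalentFunctions.

(** * The Schwarz-Pick lemma *)

Section SchwarzPick.
Local Open Scope R_scope.

Lemma schwarz_derivative (H : C -> C) (l : C) :
  (forall z, unit_disk z -> exists k, cderiv H z k) ->
  (forall z, unit_disk z -> unit_disk (H z)) ->
  H 0 = 0 -> cderiv H 0 l -> Cmod l <= 1.
Proof.
unfold unit_disk; intros Hd Hm H0 Hl.
destruct (Rle_lt_dec (Cmod l) 1) as [|Hgt]; [easy|exfalso].
(* Strictly between 1 / |l| and 1: Cauchy's estimate gives |l| r <= 1, whereas |l| r = (|l| + 1) / 2
   > 1. *)
set (r := (1 + / Cmod l) / 2).
assert (Hi : 0 < / Cmod l < 1).
{ split; [apply Rinv_0_lt_compat; lra|]. rewrite <- Rinv_1; apply Rinv_lt_contravar; lra. }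
assert (Hr : 0 < r < 1) by (unfold r; lra).
assert (B : Cmod l <= 1 / r).
{ apply (cauchy_estimate H 0); [lra| |easy|].
  - intros z Hz; apply Hd. replace (z - 0)%C with z in Hz by ring; lra.
  - intros z Hz; rewrite H0. replace (z - 0)%C with z in Hz by ring.
    replace (H z - 0)%C with (H z) by ring; left; apply Hm; lra. }
apply Rle_div_r in B; [|lra].
unfold r in B.
assert (Cmod l * / Cmod l = 1) by (field; lra).
nra.
Qed.

(** The disk automorphism that sends 0 to a; its inverse is [moebius (- a)]. *)
Definition moebius (a z : C) : C := ((z + a) / (1 + Cconj a * z))%C.

Lemma moebius_denominator (a z : C) :
  Cmod a < 1 -> Cmod z < 1 -> Cmod (z + a) < Cmod (1 + Cconj a * z).
Proof.
intros Ha Hz.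
pose proof (Cmod_ge_0 a); pose proof (Cmod_ge_0 z).
pose proof (Cmod_ge_0 (1 + Cconj a * z)).
assert (E : Cmod (1 + Cconj a * z) ^ 2 - Cmod (z + a) ^ 2 = (1 - Cmod a ^ 2) * (1 - Cmod z ^ 2)).
{ rewrite !Cmod2_alt; destruct a, z; unfold Re, Im; simpl; ring. }
assert (P : 0 < (1 - Cmod a ^ 2) * (1 - Cmod z ^ 2)) by (apply Rmult_lt_0_compat; nra).
apply Rnot_le_lt; intros Hle.
assert (Cmod (1 + Cconj a * z) ^ 2 <= Cmod (z + a) ^ 2) by (apply pow_incr; lra).
lra.
Qed.

Lemma moebius_denominator_neq_0 (a z : C) :
  Cmod a < 1 -> Cmod z < 1 -> (1 + Cconj a * z)%C <> 0.
Proof.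
intros Ha Hz; apply Cmod_gt_0.
pose proof (moebius_denominator a z Ha Hz); pose proof (Cmod_ge_0 (z + a)); lra.
Qed.

Lemma moebius_disk (a z : C) : Cmod a < 1 -> Cmod z < 1 -> Cmod (moebius a z) < 1.
Proof.
intros Ha Hz; unfold moebius.
pose proof (moebius_denominator_neq_0 a z Ha Hz) as Hn.
rewrite Cmod_div by easy.
apply Rlt_div_l; [now apply Cmod_gt_0|].
pose proof (moebius_denominator a z Ha Hz); lra.
Qed.

Lemma cderiv_moebius (a z : C) :
  Cmod a < 1 -> Cmod z < 1 ->
  cderiv (moebius a) z
    ((1 - a * Cconj a) / ((1 + Cconj a * z) * (1 + Cconj a * z))).
Proof.
intros Ha Hz; pose proof (moebius_denominator_neq_0 a z Ha Hz) as Hn.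
unfold moebius; eapply cderiv_eq.
- apply cderiv_div.
  + apply cderiv_plus; [apply cderiv_id|apply cderiv_const].
  + apply cderiv_plus; [apply cderiv_const|].
    apply cderiv_mult; [apply cderiv_const|apply cderiv_id].
  + exact Hn.
- cbv beta; field; exact Hn.
Qed.

Lemma one_minus_Cmod2 (a : C) : (1 - a * Cconj a)%C = RtoC (1 - Cmod a ^ 2).
Proof. rewrite <- Cmod2_conj; now rewrite RtoC_minus. Qed.

(** Composing g with the automorphisms that move z0 and g z0 to 0 reduces to Schwarz's lemma; the
    chain rule at 0 produces the two factors 1 - |.|^2. *)
Theorem schwarz_pick (g : C -> C) (z0 l : C) :
  (forall z, unit_disk z -> exists k, cderiv g z k) ->
  (forall z, unit_disk z -> unit_disk (g z)) ->
  unit_disk z0 -> cderiv g z0 l ->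
  Cmod l * (1 - Cmod z0 ^ 2) <= 1 - Cmod (g z0) ^ 2.
Proof.
unfold unit_disk; intros Hd Hm Hz0 Hl.
set (b := g z0).
assert (Hb : Cmod b < 1) by now apply Hm.
assert (Hb' : Cmod (- b) < 1) by now rewrite Cmod_opp.
assert (H0 : Cmod 0 < 1) by (rewrite Cmod_0; lra).
assert (M0 : moebius z0 0 = z0) by (unfold moebius; field; apply C1_nz).
pose proof (Cmod_ge_0 b) as Pb.
assert (HB : 0 < 1 - Cmod b ^ 2) by nra.
assert (Hbb : (1 + Cconj (- b) * b)%C = RtoC (1 - Cmod b ^ 2))
  by (rewrite <- one_minus_Cmod2, Copp_conj; ring).
assert (HBC : RtoC (1 - Cmod b ^ 2) <> 0) by (intros E; apply RtoC_inj in E; lra).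
set (H := fun z => moebius (- b) (g (moebius z0 z))).
assert (HD : forall z k, Cmod z < 1 -> cderiv g (moebius z0 z) k ->
  cderiv H z ((1 - - b * Cconj (- b))
     / ((1 + Cconj (- b) * g (moebius z0 z)) * (1 + Cconj (- b) * g (moebius z0 z)))
     * (k * ((1 - z0 * Cconj z0) / ((1 + Cconj z0 * z) * (1 + Cconj z0 * z)))))%C).
{ intros z k Hz Hk.
  apply (cderiv_comp (moebius (- b)) (fun z => g (moebius z0 z))).
  - apply cderiv_moebius; [easy|]. now apply Hm, moebius_disk.
  - apply (cderiv_comp g (moebius z0)); [easy|]. now apply cderiv_moebius. }
assert (B : Cmod (l * RtoC (1 - Cmod z0 ^ 2) / RtoC (1 - Cmod b ^ 2)) <= 1).
{ apply (schwarz_derivative H).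
  - intros z Hz; destruct (Hd (moebius z0 z)) as [k Hk]; [now apply moebius_disk|].
    eexists; apply (HD z k Hz Hk).
  - intros z Hz; apply moebius_disk; [easy|]. now apply Hm, moebius_disk.
  - unfold H; rewrite M0; unfold moebius. change (g z0) with b; rewrite Hbb.
    field; exact HBC.
  - rewrite <- M0 in Hl; eapply cderiv_eq; [apply (HD 0 l H0 Hl)|].
    rewrite M0; change (g z0) with b; rewrite Hbb, !one_minus_Cmod2, Cmod_opp.
    field; auto using C1_nz. }
rewrite Cmod_div, Cmod_mult, !Cmod_R, (Rabs_right (1 - Cmod b ^ 2)) in B by (easy || lra).
pose proof (Cmod_ge_0 z0).
rewrite Rabs_right in B by nra.
apply Rle_div_l in B; lra.
Qed.

End SchwarzPick.

(** * Conformal maps onto convex domains *)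

Section ConvexImages.
Local Open Scope R_scope.

Lemma is_derive_nonneg_at_min (p : R -> R) (l : R) :
  is_derive p 0 l -> p 0 = 0 -> (forall t, 0 < t < 1 -> 0 <= p t) -> 0 <= l.
Proof.
intros Hp H0 Hpos.
apply is_derive_Reals in Hp.
apply Rnot_lt_le; intros Hl.
destruct (Hp (- l)) as [d Hd]; [lra|].
set (t := Rmin (d / 2) (1 / 2)).
pose proof (cond_pos d) as Pd.
assert (Ht : 0 < t) by (apply Rmin_pos; lra).
assert (Ht1 : t <= 1 / 2) by apply Rmin_r.
assert (Ht2 : t <= d / 2) by apply Rmin_l.
specialize (Hd t ltac:(lra)); rewrite Rabs_right in Hd by lra; specialize (Hd ltac:(lra)).
rewrite Rplus_0_l, H0, Rminus_0_r in Hd.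
apply Rabs_def2 in Hd; destruct Hd as [Hd _].
assert (0 <= p t / t) by (apply Rle_div_r; [lra|]; rewrite Rmult_0_l; apply Hpos; lra).
lra.
Qed.

Lemma cderiv_C_derive (f : C -> C) (A : C -> Prop) (z : C) :
  holomorphic_on A f -> A z -> cderiv f z (C_derive f z).
Proof. intros Hf Hz; apply cderiv_is_derive, C_derive_correct; [exact z|now apply Hf]. Qed.

Lemma disk_ball (z0 z : C) : Cmod (z - z0) < 1 - Cmod z0 -> unit_disk z.
Proof.
intros H; unfold unit_disk; pose proof (Cmod_triangle (z - z0) z0) as T.
replace (z - z0 + z0)%C with z in T by ring; lra.
Qed.

Lemma conformal_derivative_neq_0 (f : C -> C) (z : C) :
  conformal_on unit_disk f -> unit_disk z -> C_derive f z <> 0.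
Proof.
intros [Hf Hinj] Hz.
apply (univalent_derivative_neq_0 f (C_derive f) z (1 - Cmod z)).
- unfold unit_disk in Hz; lra.
- intros x Hx; apply (cderiv_C_derive f unit_disk); [easy|now apply (disk_ball z)].
- intros x y Hx Hy; apply Hinj; now apply (disk_ball z).
Qed.

Lemma cderiv_C_derive_C_derive (f : C -> C) (z : C) :
  holomorphic_on unit_disk f -> unit_disk z ->
  cderiv (C_derive f) z (C_derive (C_derive f) z).
Proof.
intros Hf Hz.
destruct (holomorphic_derivative f (C_derive f) z (1 - Cmod z)) as [l Hl].
- unfold unit_disk in Hz; lra.
- intros x Hx; apply (cderiv_C_derive f unit_disk); [easy|now apply (disk_ball z)].
- pose proof (is_C_derive_unique _ _ _ (proj1 (cderiv_is_derive _ _ _) Hl)) as E.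
  now rewrite E.
Qed.

(** Injectivity makes phi the inverse of f on the image. Openness of f on arbitrarily small disks
    about z supplies the continuity of phi at f z and a neighbourhood on which f o phi is the
    identity. *)
Lemma cderiv_conformal_inverse (f phi : C -> C) (z : C) :
  conformal_on unit_disk f ->
  (forall x, unit_disk x -> unit_disk (phi (f x)) /\ f (phi (f x)) = f x) ->
  unit_disk z -> cderiv phi (f z) (/ C_derive f z).
Proof.
intros Hc Hphi Hz; pose proof Hc as [Hf Hinj].
assert (Hpf : forall x, unit_disk x -> phi (f x) = x).
{ intros x Hx; destruct (Hphi x Hx) as [H1 H2]; now apply Hinj. }
assert (Hopen : forall r, 0 < r < 1 - Cmod z -> exists d, 0 < d /\
  forall w, Cmod (w - f z) < d -> exists x, Cmod (x - z) <= r /\ f x = w).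
{ intros r Hr; apply open_mapping_at; [lra| |].
  - intros x Hx; exists (C_derive f x); apply (cderiv_C_derive f unit_disk); [easy|].
    apply (disk_ball z); lra.
  - intros x Hx E; apply Hinj in E; [|apply (disk_ball z); lra|easy].
    rewrite E, Cmod_self_minus in Hx; lra. }
unfold unit_disk in Hz.
destruct (Hopen ((1 - Cmod z) / 2)) as [d [Hd HH]]; [lra|].
apply (cderiv_inverse f phi z (C_derive f z) d).
- now apply (cderiv_C_derive f unit_disk).
- now apply conformal_derivative_neq_0.
- now apply Hpf.
- easy.
- intros w Hw; destruct (HH w Hw) as [x [Hx <-]]; apply Hphi, (disk_ball z); lra.
- intros eps Heps.
  set (r := Rmin (eps / 2) ((1 - Cmod z) / 2)).
  assert (Hr : 0 < r) by (apply Rmin_pos; lra).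
  assert (Hr1 : r <= eps / 2) by apply Rmin_l.
  assert (Hr2 : r <= (1 - Cmod z) / 2) by apply Rmin_r.
  destruct (Hopen r) as [d' [Hd' HH']]; [lra|].
  exists d'; split; [easy|]; intros w Hw.
  destruct (HH' w Hw) as [x [Hx <-]].
  rewrite !Hpf; [lra|easy|apply (disk_ball z); lra].
Qed.

(* Schwarz-Pick for the self-maps [f^-1 o ((1 - t) f + t q)] of the disk at [z0]; at [t = 0] both
   sides agree. *)
Lemma convex_density_le (f phi : C -> C) (Omega : C -> Prop) (z0 q : C) (t : R) :
  convex Omega -> conformal_on unit_disk f ->
  (forall w, Omega w <-> image f unit_disk w) ->
  (forall w, Omega w -> unit_disk (phi w) /\ f (phi w) = w) ->
  unit_disk z0 -> Omega q -> 0 <= t < 1 ->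
  let z := phi (f z0 + t * (q - f z0))%C in
  (1 - t) * Cmod (C_derive f z0) * (1 - Cmod z0 ^ 2)
  <= Cmod (C_derive f z) * (1 - Cmod z ^ 2).
Proof.
intros Hconv Hc HOm Hphi Hz0 Hq Ht z; pose proof Hc as [Hf Hinj].
assert (Hfx : forall x, unit_disk x -> Omega (f x)) by (intros x Hx; apply HOm; now exists x).
set (h := fun x => (RtoC (1 - t) * f x + RtoC t * q)%C).
assert (Hh : forall x, unit_disk x -> Omega (h x)).
{ intros x Hx; apply Hconv; auto; lra. }
assert (Hd : forall x, unit_disk x ->
  cderiv (fun x => phi (h x)) x (/ C_derive f (phi (h x)) * (RtoC (1 - t) * C_derive f x))%C).
{ intros x Hx; destruct (Hphi _ (Hh x Hx)) as [D E].
  apply (cderiv_comp phi h).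
  - rewrite <- E at 1; apply cderiv_conformal_inverse; auto.
  - unfold h; eapply cderiv_eq.
    + apply cderiv_plus; [|apply cderiv_const].
      apply cderiv_mult; [apply cderiv_const|].
      apply (cderiv_C_derive f unit_disk); auto.
    + cbv beta; ring. }
pose proof (schwarz_pick (fun x => phi (h x)) z0 _
  ltac:(intros x Hx; eexists; apply Hd, Hx)
  ltac:(intros x Hx; apply Hphi, Hh, Hx) Hz0 (Hd z0 Hz0)) as B.
assert (E : phi (h z0) = z) by (unfold z, h; f_equal; rewrite RtoC_minus; ring).
cbv beta in B; rewrite E in B.
assert (Hz : unit_disk z) by (rewrite <- E; apply Hphi, Hh, Hz0).
pose proof (conformal_derivative_neq_0 f z Hc Hz) as Hn.
pose proof (proj1 (Cmod_gt_0 _) Hn) as P.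
rewrite !Cmod_mult, Cmod_R, Rabs_right, Cmod_inv in B by (easy || lra).
apply (Rmult_le_compat_l (Cmod (C_derive f z))) in B; [|lra].
eapply Rle_trans; [right|apply B]; field; lra.
Qed.

Lemma Omega_half_plane_le (f : C -> C) (Omega : C -> Prop) (z0 q : C) :
  convex Omega -> conformal_on unit_disk f ->
  (forall w, Omega w <-> image f unit_disk w) ->
  unit_disk z0 -> Omega q ->
  Re ((q - f z0) * (AW_denominator f z0 / AW_numerator f z0)) <= 1 / 2.
Proof.
intros Hconv Hc HOm Hz0 Hq; pose proof Hc as [Hf Hinj].
(* Chooses an inverse of f on [Omega]; nothing is required of its values elsewhere. *)
destruct (functional_choice (fun w z => Omega w -> unit_disk z /\ f z = w)) as [phi Hphi].
{ intros w; destruct (classic (Omega w)) as [Hw|Hw].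
  - destruct (proj1 (HOm w) Hw) as [z Hz]; now exists z.
  - now exists (RtoC 0). }
pose proof (convex_density_le f phi Omega z0 q) as HP.
set (N := C_derive f z0) in *.
assert (HN : N <> 0) by now apply conformal_derivative_neq_0.
pose proof (proj1 (Cmod_gt_0 _) HN) as PN.
set (M := C_derive (C_derive f) z0).
assert (Hw0 : Omega (f z0)) by (apply HOm; now exists z0).
assert (Hpz0 : phi (f z0) = z0).
{ destruct (Hphi _ Hw0) as [H1 H2]; now apply Hinj. }
assert (E0 : (f z0 + RtoC 0 * (q - f z0))%C = f z0) by ring.
set (Z := fun s : C => phi (f z0 + s * (q - f z0))%C).
set (Z' := ((q - f z0) / N)%C).
assert (HZ0 : Z 0 = z0) by (unfold Z; now rewrite E0).
assert (HZ : cderiv Z 0 Z').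
{ eapply cderiv_eq; [apply (cderiv_comp phi (fun s => f z0 + s * (q - f z0))%C)|].
  - rewrite E0; apply (cderiv_conformal_inverse f phi z0 Hc); [|easy].
    intros x Hx; apply Hphi, HOm; now exists x.
  - apply cderiv_affine.
  - unfold Z', N; field; exact HN. }
assert (HF : cderiv (fun s => C_derive f (Z s)) 0 (M * Z')%C).
{ apply (cderiv_comp (C_derive f) Z); [|easy].
  rewrite HZ0; now apply cderiv_C_derive_C_derive. }
destruct (is_derive_restrict_real _ _ _ HZ) as [DZ1 DZ2].
destruct (is_derive_restrict_real _ _ _ HF) as [DF1 DF2].
set (D := 1 - Cmod z0 ^ 2).
assert (HD : 0 < D) by (pose proof (Cmod_ge_0 z0); unfold D, unit_disk in *; nra).
set (z1 := fun s : R => fst (Z s)) in *; set (z2 := fun s : R => snd (Z s)) in *.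
set (n1 := fun s : R => fst (C_derive f (Z s))) in *.
set (n2 := fun s : R => snd (C_derive f (Z s))) in *.
(* The difference of the squared sides of the density inequality: squaring makes it polynomial in
   real coordinates, so no modulus is differentiated. It vanishes at 0 and is nonnegative on (0,
   1). *)
set (p := fun s : R => (n1 s ^ 2 + n2 s ^ 2) * (1 - (z1 s ^ 2 + z2 s ^ 2)) ^ 2
  - (1 - s) ^ 2 * (Cmod N ^ 2 * D ^ 2)).
assert (Hz12 : z1 0 = fst z0 /\ z2 0 = snd z0) by (unfold z1, z2; now rewrite HZ0).
assert (Hn12 : n1 0 = fst N /\ n2 0 = snd N) by (unfold n1, n2; now rewrite HZ0).
assert (Hp : is_derive p 0 (2 * (fst N * fst (M * Z')%C + snd N * snd (M * Z')%C) * D ^ 2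
  - 4 * Cmod N ^ 2 * D * (fst z0 * fst Z' + snd z0 * snd Z') + 2 * Cmod N ^ 2 * D ^ 2)).
{ unfold p. destruct Hz12 as [E1 E2], Hn12 as [E3 E4].
  auto_derive.
  - repeat split; eexists; eassumption.
  - assert (Y1 : Derive (fun s : R => z1 s) 0 = fst Z') by apply is_derive_unique, DZ1.
    assert (Y2 : Derive (fun s : R => z2 s) 0 = snd Z') by apply is_derive_unique, DZ2.
    assert (Y3 : Derive (fun s : R => n1 s) 0 = fst (M * Z')%C) by apply is_derive_unique, DF1.
    assert (Y4 : Derive (fun s : R => n2 s) 0 = snd (M * Z')%C) by apply is_derive_unique, DF2.
    rewrite Y1, Y2, Y3, Y4, E1, E2, E3, E4.
    change (Cmod N * (Cmod N * 1)) with (Cmod N ^ 2).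
    assert (X1 : Cmod N ^ 2 = fst N ^ 2 + snd N ^ 2) by apply Cmod2_alt.
    assert (X2 : D = 1 - (fst z0 ^ 2 + snd z0 ^ 2)) by (unfold D; f_equal; apply Cmod2_alt).
    rewrite X1, X2; ring. }
assert (Hpos : 0 <= 2 * (fst N * fst (M * Z')%C + snd N * snd (M * Z')%C) * D ^ 2
  - 4 * Cmod N ^ 2 * D * (fst z0 * fst Z' + snd z0 * snd Z') + 2 * Cmod N ^ 2 * D ^ 2).
{ apply (is_derive_nonneg_at_min p); [exact Hp| |].
  - unfold p. destruct Hz12 as [-> ->], Hn12 as [-> ->].
    assert (X1 : Cmod N ^ 2 = fst N ^ 2 + snd N ^ 2) by apply Cmod2_alt.
    assert (X2 : D = 1 - (fst z0 ^ 2 + snd z0 ^ 2)) by (unfold D; f_equal; apply Cmod2_alt).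
    rewrite X1, X2; ring.
  - intros t Ht; specialize (HP t Hconv Hc HOm Hphi Hz0 Hq ltac:(lra)); cbv zeta in HP.
    change (phi (f z0 + t * (q - f z0))%C) with (Z t) in HP.
    assert (Y1 : Cmod (C_derive f (Z t)) ^ 2 = n1 t ^ 2 + n2 t ^ 2) by apply Cmod2_alt.
    assert (Y2 : Cmod (Z t) ^ 2 = z1 t ^ 2 + z2 t ^ 2) by apply Cmod2_alt.
    fold D in HP.
    unfold p; rewrite <- Y1, <- Y2.
    assert (Q : 0 <= (1 - t) * Cmod N * D) by (repeat apply Rmult_le_pos; lra).
    pose proof (pow_incr _ _ 2 (conj Q HP)) as HP2.
    rewrite !Rpow_mult_distr in HP2; lra. }
(* Since Z' = (q - f z0) / N, the product is conj z0 Z' / D - M Z' / (2 N); multiplying the last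
   fraction by conj N above and below leaves real inner products. *)
assert (E : Re ((q - f z0) * (AW_denominator f z0 / AW_numerator f z0))
  = (fst z0 * fst Z' + snd z0 * snd Z') / D
    - (fst N * fst (M * Z')%C + snd N * snd (M * Z')%C) / (2 * Cmod N ^ 2)).
{ unfold AW_denominator, AW_numerator; fold D N M.
  assert (HDC : RtoC D <> 0) by (intros X; apply RtoC_inj in X; lra).
  assert (HCN : RtoC (2 * Cmod N ^ 2) <> 0) by (intros X; apply RtoC_inj in X; nra).
  assert (H2 : RtoC 2 <> 0) by (intros X; apply RtoC_inj in X; lra).
  assert (HNc : Cconj N <> 0) by (apply Cmod_gt_0; now rewrite Cmod_conj).
  assert (X : ((q - f z0) * ((Cconj z0 - RtoC D * (M / (2 * N))) / (RtoC D * N))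
    = RtoC (/ D) * (Cconj z0 * Z') - RtoC (/ (2 * Cmod N ^ 2)) * (Cconj N * (M * Z')))%C).
  { rewrite !RtoC_inv by nra.
    replace (RtoC (2 * Cmod N ^ 2)) with (2 * (N * Cconj N))%C
      by (now rewrite <- Cmod2_conj, RtoC_mult).
    unfold Z'; field; auto. }
  rewrite X.
  destruct z0 as [x0 y0], Z' as [x' y'], (M * (x', y'))%C as [u v], N as [a b].
  unfold Re; simpl; field; split; simpl in *; lra. }
rewrite E.
set (A := fst z0 * fst Z' + snd z0 * snd Z') in *.
set (B := fst N * fst (M * Z')%C + snd N * snd (M * Z')%C) in *.
assert (HN2 : 0 < Cmod N ^ 2) by (apply pow_lt; lra).
assert (HND : 0 < 4 * Cmod N ^ 2 * D ^ 2) by (apply Rmult_lt_0_compat; [lra|apply pow_lt; lra]).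
(* Clearing denominators with this factor turns the goal into the nonnegativity of the derivative of
   p at 0. *)
apply Rmult_le_reg_l with (4 * Cmod N ^ 2 * D ^ 2); [easy|].
replace (4 * Cmod N ^ 2 * D ^ 2 * (A / D - B / (2 * Cmod N ^ 2)))
  with (4 * Cmod N ^ 2 * D * A - 2 * B * D ^ 2) by (field; lra).
lra.
Qed.

End ConvexImages.

(** * Strict half-planes and the equation of the mediatrix *)

Section HalfPlane.
Local Open Scope R_scope.

(** At a point of equality, a small step s conj k would stay in the open set and raise the real part
    by s |k|^2 > 0. *)
Lemma open_half_plane_strict (Omega : C -> Prop) (w k : C) (a : R) :
  open (T := C_UniformSpace) Omega -> k <> 0 ->
  (forall q, Omega q -> Re ((q - w) * k) <= a) ->
  forall q, Omega q -> Re ((q - w) * k) < a.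
Proof.
intros Hop Hk Hle q Hq.
destruct (Hop q Hq) as [e He].
pose proof (proj1 (Cmod_gt_0 k) Hk) as Pk; pose proof (cond_pos e) as Pe.
set (s := e / (2 * Cmod k)).
assert (Hs : 0 < s) by (apply Rdiv_lt_0_compat; lra).
assert (Hq' : Omega (q + RtoC s * Cconj k)%C).
{ apply He, C_NormedModule_mixin_compat1.
  change (Cmod (q + RtoC s * Cconj k - q) < e).
  replace (q + RtoC s * Cconj k - q)%C with (RtoC s * Cconj k)%C by ring.
  rewrite Cmod_mult, Cmod_R, Cmod_conj, Rabs_right by lra.
  unfold s; replace (e / (2 * Cmod k) * Cmod k) with (e / 2) by (field; lra); lra. }
apply Hle in Hq'.
replace ((q + RtoC s * Cconj k - w) * k)%C
  with ((q - w) * k + RtoC s * (k * Cconj k))%C in Hq' by ring.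
rewrite <- Cmod2_conj, <- RtoC_mult, re_plus, re_RtoC in Hq'.
assert (0 < s * Cmod k ^ 2) by (apply Rmult_lt_0_compat; [easy|now apply pow_lt]).
lra.
Qed.

(** In the coordinate (q - w) / (v - w) the endpoints w and v become 0 and 1, and their mediatrix
    becomes the vertical line through 1/2. *)
Lemma mediatrix_Re (w v q : C) :
  v <> w -> mediatrix w (Fin v) (Fin q) -> Re ((q - w) * / (v - w)) = 1 / 2.
Proof.
intros Hvw H; change (Re ((q - (w + v) / 2) * Cconj (v - w)) = 0) in H.
set (u := (v - w)%C) in *.
assert (Hu : u <> 0) by now apply Cminus_eq_contra.
assert (Huc : Cconj u <> 0) by (apply Cmod_gt_0; rewrite Cmod_conj; now apply Cmod_gt_0).
pose proof (proj1 (Cmod_gt_0 u) Hu) as Pu.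
assert (H2 : RtoC 2 <> 0) by (intros X; apply RtoC_inj in X; lra).
assert (HC : RtoC (Cmod u ^ 2) <> 0) by (intros X; apply RtoC_inj in X; nra).
assert (E : ((q - w) * / u = RtoC (/ Cmod u ^ 2) * ((q - (w + v) / 2) * Cconj u) + RtoC (1 / 2))%C).
{ rewrite RtoC_inv, RtoC_div, Cmod2_conj by nra.
  replace v with (w + u)%C by (unfold u; ring). field; auto. }
rewrite E, re_plus, re_scal_l, H, re_RtoC; ring.
Qed.

End HalfPlane.

Theorem theorem3p1
  (Omega : C -> Prop) (f : C -> C) (refl : C -> Chat)
  (Omega_convex : convex_domain Omega)
  (f_conformal : conformal_on unit_disk f)
  (Omega_image : forall w : C, Omega w <-> image f unit_disk w)
  (refl_AW : is_AW_reflection f refl) :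
  forall w : C, Omega w ->
    (forall p : Chat, ~ (in_plane_set Omega p /\ mediatrix w (refl w) p))
    /\ ~ in_plane_set Omega (midpoint w (refl w)).
Proof.
intros w Hw.
assert (Hmed : forall p : Chat, ~ (in_plane_set Omega p /\ mediatrix w (refl w) p)).
{ destruct Omega_convex as [Hop [_ Hconv]].
  destruct (proj1 (Omega_image w) Hw) as [z [Hz <-]].
  intros [q|] [Hq Hm]; [|exact Hq]; simpl in Hq.
  rewrite (refl_AW z Hz) in Hm; unfold AW_value in Hm.
  (* For an infinite reflection the mediatrix contains no finite point. *)
  destruct (Ceq_dec (AW_denominator f z) 0) as [_|Hden]; [exact Hm|].
  assert (Hnum : AW_numerator f z <> 0).
  { apply Cmult_neq_0; [|now apply conformal_derivative_neq_0].
    unfold unit_disk in Hz; pose proof (Cmod_ge_0 z).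
    intros E; apply RtoC_inj in E; nra. }
  set (N := AW_numerator f z) in *; set (D := AW_denominator f z) in *.
  assert (HDN : (D / N)%C <> 0).
  { apply Cmult_neq_0; [easy|]; intros E; apply C1_nz.
    rewrite <- (Cinv_r N Hnum), E; ring. }
  assert (Ev : (f z + N / D - f z = N / D)%C) by ring.
  apply mediatrix_Re in Hm.
  - rewrite Ev in Hm; replace (/ (N / D))%C with (D / N)%C in Hm by (field; auto).
    pose proof (open_half_plane_strict Omega (f z) (D / N)%C (1 / 2) Hop HDN
      (fun q Hq => Omega_half_plane_le f Omega z q Hconv f_conformal Omega_image Hz Hq) q Hq).
    lra.
  (* The segment is not degenerate: a reflection equal to f z would make the numerator vanish. *)
  - intros E; rewrite E in Ev; apply Hnum.
    replace N with (N / D * D)%C by (field; auto); rewrite <- Ev; ring. }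
split; [exact Hmed|].
(* The midpoint lies on the mediatrix, also when both are at infinity, so the second claim is an
   instance of the first. *)
intros HP; apply (Hmed (midpoint w (refl w))); split; [exact HP|].
destruct (refl w) as [v|]; [|exact I].
change (Re (((w + v) / 2 - (w + v) / 2) * Cconj (v - w)) = 0%R).
replace ((w + v) / 2 - (w + v) / 2)%C with (RtoC 0) by ring.
rewrite Cmult_0_l; reflexivity.
Qed.
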